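(* Let $0 \le \varepsilon, \rho \le 1$. There exists a $\rho$-replicable algorithm for hypothesis selection with multiplicative approximation constant $C = 3$ which succeeds with high probability in $n$ and takes $O\left(\frac{\log^5 n}{\varepsilon^2 \rho^2}\right)$ samples in the worst case and $O\left(\frac{\log^5 n}{\varepsilon^2 \rho}\right)$ samples in expectation.
   Context: Hypothesis selection: there is a known collection of distributions $\mathcal{H} = \{H_1, \dots, H_n\}$, all over the same domain. Given i.i.d. samples from an unknown distribution $P$ over that domain, the goal is to output an index $i \in [n]$ such that $d_{TV}(H_i, P) \le C \cdot \min_{H \in \mathcal{H}} d_{TV}(H, P) + \varepsilon$, where $d_{TV}$ denotes total variation distance, $C$ is a constant and $\varepsilon$ is the desired additive error. A randomized algorithm $\mathcal{A}(X; r)$ (with samples $X$ and internal randomness $r$) is $\rho$-replicable if for every distribution $\mathcal{D}$ over the sample space, $\Pr_{X, X', r}[\mathcal{A}(X; r) = \mathcal{A}(X'; r)] \ge 1 - \rho$, where $X, X'$ are independent sequences of i.i.d. samples from $\mathcal{D}$ and the same internal randomness $r$ is used in both runs. *)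

(* Defs.v *)
From HB Require Import structures.
From mathcomp Require Import all_boot all_order all_algebra.
From mathcomp Require Import all_classical all_reals all_analysis.
From mathcomp Require Import measurable_realfun.

Set Implicit Arguments.
Unset Strict Implicit.
Unset Printing Implicit Defensive.

Import Order.TTheory GRing.Theory Num.Theory.
Import numFieldNormedType.Exports.

Local Open Scope classical_set_scope.
Local Open Scope ring_scope.

Fact cylinder_display : measure_display -> measure_display.
Proof. exact. Qed.

Section rectangles.
Context d (T : measurableType d).

Definition rect (A : nat -> set T) : set (nat -> T) :=
  [set x | forall k, A k (x k)].

(* Rectangles constraining finitely many coordinates; they form a semiring of
   sets generating the product sigma-algebra on sequences. *)
Definition rectangle (C : set (nat -> T)) := exists A m,
  [/\ forall k, measurable (A k), forall k, (m <= k)%N -> A k = setT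
    & C = rect A].

Lemma rectangle0 : rectangle set0.
Proof.
exists (fun k => if k == 0%N then set0 else setT), 1%N; split.
- by move=> k; case: ifP.
- by case.
- by apply/seteqP; split => // x /(_ 0%N).
Qed.

Lemma rectangleI : setI_closed rectangle.
Proof.
move=> _ _ [A [m [mA Am ->]]] [B [n [mB Bn ->]]].
exists (fun k => A k `&` B k), (maxn m n); split.
- by move=> k; exact: measurableI.
- by move=> k; rewrite geq_max => /andP[mk nk]; rewrite Am// Bn// setIT.
- apply/seteqP; split => [x [Ax Bx] k|x ABx]; first by split.
  by split=> k; have [] := ABx k.
Qed.

Lemma rectangleD : semi_setD_closed rectangle.
Proof.
move=> _ _ [A [m [mA Am ->]]] [B [n [mB Bn ->]]].
pose E k i := if (i < k)%N then A i `&` B i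
              else if i == k then A i `\` B i else A i.
pose D k := rect (E k).
exists (D @` `I_n); split.
- exact/finite_image/finite_II.
- move=> _ [k /= kn <-]; exists (E k), (maxn m n); split; last by [].
  + move=> i; rewrite /E; case: ifP => _; first exact: measurableI.
    by case: ifP => _ //; exact: measurableD.
  + move=> i; rewrite geq_max => /andP[mi ni].
    by rewrite /E ltnNge ltnW ?(leq_trans kn)// gtn_eqF ?(leq_trans kn)//= Am.
- apply/seteqP; split.
  + move=> x [Ax]; rewrite /rect/= => /existsNP[k0 nB].
    have ex : exists k, ~~ `[< B k (x k) >] by exists k0; apply/asboolPn.
    case: (find_ex_minn ex) => l /asboolPn nBl lmin.
    exists (D l).
      exists l => //=; rewrite ltnNge; apply/negP => nl; apply: nBl.
      by rewrite Bn.
    move=> i; rewrite /E; case: ifP => il.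
      split => //; apply: contrapT => /asboolPn /lmin.
      by rewrite leqNgt il.
    by case: eqP => [->|] //; split.
  + move=> x [_ [k /= kn <-]] Dx; split.
      move=> i; have := Dx i; rewrite /E.
      by case: ifP => _; [case|case: ifP => _ //; case].
    by move=> /(_ k); have := Dx k; rewrite /E ltnn eqxx => -[].
- move=> _ _ [j _ <-] [k _ <-] [x [Dj Dk]].
  have [jk|kj|->//] := ltngtP j k.
    by have := Dj j; have := Dk j; rewrite /E jk ltnn eqxx => -[_ ?] [].
  by have := Dj k; have := Dk k; rewrite /E kj ltnn eqxx => -[? ?] [].
Qed.

Definition cylinders := (nat -> T).

HB.instance Definition _ := Pointed.on cylinders.

HB.instance Definition _ := isSemiRingOfSets.Build (cylinder_display d)
  cylinders rectangle0 rectangleI rectangleD.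

End rectangles.

Definition stream d (T : measurableType d) : measurableType _ :=
  g_sigma_algebraType (@measurable _ (cylinders T)).

Section product_premeasure.
Context (R : realType) d (T : measurableType d) (P : probability T R).

Let p (A : set T) : R := fine (P A).

Let p_ge0 A : 0 <= p A. Proof. exact: fine_ge0. Qed.

Let upd m (x : nat -> T) t : nat -> T := fun i => if i == m then t else x i.

(* The conditional weight of the rectangle A given the first m samples. *)
Let w (A : nat -> set T) N m (x : nat -> T) : R :=
  \prod_(i < N) (if (i < m)%N then \1_(A i) (x i) else p (A i)).

Let w_ge0 A N m x : 0 <= w A N m x.
Proof. by apply: prodr_ge0 => i _; case: ifP. Qed.

Let w_ext A N m x y : (forall i, (i < m)%N -> x i = y i) ->
  w A N m x = w A N m y.
Proof. by move=> xy; apply: eq_bigr => i _; case: ifP => // im; rewrite xy. Qed.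

Let w_full A N m x : (N <= m)%N -> (forall k, (N <= k)%N -> A k = setT) ->
  w A N m x = \1_(rect A) x.
Proof.
move=> Nm AN; rewrite indicE; case: (boolP (x \in rect A)) => [/set_mem xA|xA].
  rewrite /w big1// => i _; rewrite (leq_trans _ Nm)//.
  by rewrite indicE mem_set.
have [i nA] : exists i, ~ A i (x i).
  by apply/existsNP => h; move/negP: xA; apply; rewrite inE.
have iN : (i < N)%N by rewrite ltnNge; apply/negP => /AN AE; apply: nA; rewrite AE.
rewrite /w (bigD1 (Ordinal iN))//= (leq_trans iN Nm) indicE memNset ?mul0r//.
Qed.

Let w_step A N m x : (forall k, measurable (A k)) ->
  measurable_fun [set: T] (fun t => (w A N m.+1 (upd m x t))%:E : \bar R) /\
  (\int[P]_t (w A N m.+1 (upd m x t))%:E = (w A N m x)%:E)%E.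
Proof.
move=> mA.
have [Nm|mN] := leqP N m.
  have wE t : w A N m.+1 (upd m x t) = w A N m x.
    apply: eq_bigr => i _; have im : (i < m)%N by rewrite (leq_trans _ Nm).
    by rewrite ltnS (ltnW im) im /upd ltn_eqF.
  under [X in measurable_fun _ X]eq_fun do rewrite wE.
  under eq_integral do rewrite wE.
  split; first exact: measurable_cst.
  by rewrite integral_cst//= probability_setT mule1.
pose c := \prod_(i < N | i != Ordinal mN)
  (if (i < m)%N then \1_(A i) (x i) else p (A i)) : R.
have c0 : 0 <= c by apply: prodr_ge0 => i _; case: ifP.
have wE t : w A N m.+1 (upd m x t) = c * \1_(A m) t.
  rewrite /w (bigD1 (Ordinal mN))//= ltnSn {1}/upd eqxx mulrC; congr (_ * _).
  apply: eq_bigr => i; rewrite -val_eqE/= => im.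
  by rewrite ltnS leq_eqVlt (negbTE im)/= /upd (negbTE im).
have -> : w A N m x = c * p (A m).
  by rewrite /w (bigD1 (Ordinal mN))//= ltnn mulrC.
under [X in measurable_fun _ X]eq_fun do rewrite wE EFinM.
under eq_integral do rewrite wE EFinM.
have mi : measurable_fun setT (fun t => (\1_(A m) t : R)%:E).
  by apply: measurableT_comp => //; exact: measurable_indic.
split; first exact: measurable_funeM.
rewrite ge0_integralZl_EFin//=.
by rewrite integral_indic// setIT EFinM /p fineK// fin_num_measure.
Qed.

Let premeasure_le (U V : nat -> nat -> set T) (NU NV : nat -> nat) n :
  (forall j k, measurable (U j k)) -> (forall j k, measurable (V j k)) ->
  (forall j k, (NU j <= k)%N -> U j k = setT) ->
  (forall j k, (NV j <= k)%N -> V j k = setT) ->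
  (forall x, exists K, \sum_(j < n) (\1_(rect (U j)) x : R) <=
                       \sum_(j < K) (\1_(rect (V j)) x : R)) ->
  (\sum_(j < n) (\prod_(i < NU j) p (U j i))%:E <=
   \sum_(j <oo) (\prod_(i < NV j) p (V j i))%:E)%E.
Proof.
move=> mU mV hU hV UV; rewrite leNgt; apply/negP => VU.
pose Bad m x := (\sum_(0 <= j <oo) (w (V j) (NV j) m x)%:E <
  \sum_(j < n) (w (U j) (NU j) m x)%:E)%E.
have bad0 : Bad 0%N (fun=> point) by [].
have badS m x : exists t, Bad m x -> Bad m.+1 (upd m x t).
  apply: contrapT => /forallNP h.
  have {h} [bx nb] : Bad m x /\ forall t, ~ Bad m.+1 (upd m x t).
    split; first by apply: contrapT => nbx; apply: (h point) => /nbx.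
    by move=> t b; apply: (h t).
  move: bx; rewrite /Bad ltNge => /negP; apply.
  under eq_bigr do rewrite -(w_step _ _ _ (mU _)).2.
  under eq_eseriesr do rewrite -(w_step _ _ _ (mV _)).2.
  rewrite -ge0_integral_sum//; last 2 first.
    by move=> j; exact: (w_step _ _ _ (mU _)).1.
    by move=> j t _; rewrite lee_fin.
  rewrite -integral_nneseries//; last 2 first.
    by move=> j; exact: (w_step _ _ _ (mV _)).1.
    by move=> j t _; rewrite lee_fin.
  apply: ge0_le_integral => //.
  - by move=> t _; apply: sume_ge0 => j _; rewrite lee_fin.
  - by apply: emeasurable_sum => j; exact: (w_step _ _ _ (mU _)).1.
  - apply: (@ge0_emeasurable_sum _ _ _ _ _ xpredT) => j.
      by move=> t _ _; rewrite lee_fin.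
    by move=> _; exact: (w_step _ _ _ (mV _)).1.
  - by move=> t _; rewrite leNgt; apply/negP; exact: nb.
have [g gP] : {g : nat -> (nat -> T) -> T |
    forall m x, Bad m x -> Bad m.+1 (upd m x (g m x))}.
  exists (fun m x => projT1 (cid (badS m x))) => m x.
  exact: (projT2 (cid (badS m x))).
pose xs := fix xs m := if m is m'.+1 then upd m' (xs m') (g m' (xs m'))
                       else fun=> point.
have bad_xs m : Bad m (xs m) by elim: m => [//|m IH]; exact: gP.
pose x i := xs i.+1 i.
have xsE m i : (i < m)%N -> xs m i = x i.
  elim: m => // m IH; rewrite ltnS leq_eqVlt => /orP[/eqP->//|im].
  by rewrite -IH//= /upd ltn_eqF.
have bad_x m : Bad m x.
  have := bad_xs m; rewrite /Bad.
  under eq_bigr do rewrite (w_ext _ _ (xsE m)).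
  by under eq_eseriesr do rewrite (w_ext _ _ (xsE m)).
have [K UVK] := UV x.
pose m := maxn (\max_(j < n) NU j) (\max_(j < K) NV j).
have := bad_x m; rewrite /Bad ltNge => /negP; apply.
have -> : (\sum_(j < n) (w (U j) (NU j) m x)%:E)%E =
          (\sum_(j < n) (\1_(rect (U j)) x : R))%:E.
  rewrite -sumEFin; apply: eq_bigr => j _; rewrite w_full//; last exact: hU.
  by rewrite leq_max (leq_bigmax j).
apply: (@le_trans _ _ (\sum_(j < K) (\1_(rect (V j)) x : R))%:E).
  by rewrite lee_fin.
have -> : ((\sum_(j < K) (\1_(rect (V j)) x : R))%:E =
          \sum_(0 <= j < K) (w (V j) (NV j) m x)%:E)%E.
  rewrite big_mkord -sumEFin; apply: eq_bigr => j _; rewrite w_full//.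
    by rewrite leq_max (leq_bigmax j) orbT.
  exact: hV.
by apply: nneseries_lim_ge => j _ _; rewrite lee_fin.
Qed.

Let premeasure_le_fin (U V : nat -> nat -> set T) (NU NV : nat -> nat) n l :
  (forall j k, measurable (U j k)) -> (forall j k, measurable (V j k)) ->
  (forall j k, (NU j <= k)%N -> U j k = setT) ->
  (forall j k, (NV j <= k)%N -> V j k = setT) ->
  (forall x, \sum_(j < n) (\1_(rect (U j)) x : R) <=
             \sum_(j < l) (\1_(rect (V j)) x : R)) ->
  (\sum_(j < n) (\prod_(i < NU j) p (U j i))%:E <=
   \sum_(j < l) (\prod_(i < NV j) p (V j i))%:E)%E.
Proof.
move=> mU mV hU hV UV.
pose E k : set T := if k == 0%N then set0 else setT.
pose V' j := if (j < l)%N then V j else E.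
pose NV' j := if (j < l)%N then NV j else 1%N.
have lV : (\sum_(j < l) (\prod_(i < NV j) p (V j i))%:E =
           \sum_(j <oo) (\prod_(i < NV' j) p (V' j i))%:E)%E.
  rewrite (nneseries_split 0 l)/=; last first.
    by move=> j _; rewrite lee_fin prodr_ge0.
  rewrite add0n [X in (_ + X)%E]eseries0 ?adde0; last first.
    move=> j lj _; rewrite /V' /NV' ltnNge lj/= big_ord1 /E eqxx /p measure0.
    by [].
  by rewrite big_mkord; apply: eq_bigr => j _; rewrite /V' /NV' ltn_ord.
rewrite lV; apply: premeasure_le => //.
- by move=> j k; rewrite /V' /E; case: ifP => // _; case: ifP.
- by move=> j k; rewrite /V' /NV' /E; case: ifP => // _; [exact: hV|case: k].
- move=> x; exists l; rewrite (le_trans (UV x))//; apply: ler_sum => j _.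
  by rewrite /V' ltn_ord.
Qed.

Let box_ex (C : set (nat -> T)) : exists A : (nat -> set T) * nat,
  rectangle C -> [/\ forall k, measurable (A.1 k),
    forall k, (A.2 <= k)%N -> A.1 k = setT & C = rect A.1].
Proof.
have [[A [m AP]]|nC] := pselect (rectangle C); first by exists (A, m).
by exists (fun=> setT, 0%N) => /nC.
Qed.

Let box C := projT1 (cid (box_ex C)).

Let boxP C : rectangle C -> [/\ forall k, measurable ((box C).1 k),
  forall k, ((box C).2 <= k)%N -> (box C).1 k = setT & C = rect (box C).1].
Proof. exact: (projT2 (cid (box_ex C))). Qed.

Definition product_premeasure (C : set (cylinders T)) : \bar R :=
  (\prod_(i < (box C).2) p ((box C).1 i))%:E.

Let product_premeasureE A m : (forall k, measurable (A k)) ->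
  (forall k, (m <= k)%N -> A k = setT) ->
  product_premeasure (rect A) = (\prod_(i < m) p (A i))%:E.
Proof.
move=> mA Am; have [mB Bm AB] : _ := boxP (ex_intro _ A (ex_intro _ m
  (And3 mA Am erefl))).
rewrite /product_premeasure; move: (box _) mB Bm AB => [B l]/= mB Bl AB.
apply/eqP; rewrite eq_le; apply/andP; split.
  have := @premeasure_le_fin (fun=> B) (fun=> A) (fun=> l) (fun=> m) 1 1.
  by rewrite !big_ord1; apply => // x; rewrite !big_ord1 AB.
have := @premeasure_le_fin (fun=> A) (fun=> B) (fun=> m) (fun=> l) 1 1.
by rewrite !big_ord1; apply => // x; rewrite !big_ord1 AB.
Qed.

Let product_premeasure_ge0 C : (0 <= product_premeasure C)%E.
Proof. by rewrite lee_fin prodr_ge0. Qed.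

Let product_premeasure_semi_additive : measure_function.semi_additive product_premeasure.
Proof.
move=> F n mF tF mUF.
have [mA hA FA] := all_and3 (fun k => boxP (mF k)).
have [mB hB UB] := boxP mUF.
have UE x : (\1_(\big[setU/set0]_(i < n) F i) x : R) =
            \sum_(j < n) (\1_(F j) x : R).
  rewrite indicE; case: (boolP (x \in _)).
    rewrite inE -bigcup_mkord => -[k /= kn Fkx].
    rewrite (bigD1 (Ordinal kn))//= indicE mem_set// big1 ?addr0// => j jk.
    rewrite indicE memNset// => Fjx; move/eqP: jk; apply; apply/val_inj => /=.
    by apply: (tF j k) => //; exists x.
  move=> /negP nx; rewrite big1// => j _; rewrite indicE memNset// => Fjx.
  by apply: nx; rewrite inE -bigcup_mkord; exists j => /=.
apply/eqP; rewrite eq_le; apply/andP; split.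
  have := @premeasure_le_fin (fun=> (box (\big[setU/set0]_(i < n) F i)).1)
    (fun j => (box (F j)).1) (fun=> (box (\big[setU/set0]_(i < n) F i)).2)
    (fun j => (box (F j)).2) 1 n.
  rewrite big_ord1; apply => // x; rewrite big_ord1 -UB UE.
  by apply: ler_sum => j _; rewrite -FA.
have := @premeasure_le_fin (fun j => (box (F j)).1)
  (fun=> (box (\big[setU/set0]_(i < n) F i)).1) (fun j => (box (F j)).2)
  (fun=> (box (\big[setU/set0]_(i < n) F i)).2) n 1.
rewrite big_ord1; apply => // x; rewrite big_ord1 -UB UE.
by apply: ler_sum => j _; rewrite -FA.
Qed.

HB.instance Definition _ := isContent.Build _ _ _ product_premeasure
  product_premeasure_ge0 product_premeasure_semi_additive.

Let product_premeasure_sigma_subadditive :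
  measurable_subset_sigma_subadditive product_premeasure.
Proof.
move=> A F mF mA AF.
have [mB hB FB] := all_and3 (fun k => boxP (mF k)).
have [mC hC AC] := boxP mA.
have := @premeasure_le (fun=> (box A).1) (fun j => (box (F j)).1)
  (fun=> (box A).2) (fun j => (box (F j)).2) 1.
rewrite big_ord1; apply => // x; have [Ax|nAx] := pselect (A x).
  have [k _ Fkx] := AF _ Ax; exists k.+1.
  rewrite big_ord1 big_ord_recr/= -AC -FB !indicE !mem_set//.
  by rewrite lerDr sumr_ge0.
by exists 0%N; rewrite big_ord0 big_ord1 -AC indicE memNset.
Qed.

HB.instance Definition _ := Content_SigmaSubAdditive_isMeasure.Build _ _ _
  product_premeasure product_premeasure_sigma_subadditive.

(* The law of a sequence of independent samples from P, i.e. the infinite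
   product of copies of P; it is characterized by iid_rect below. *)
Definition iid : set (stream T) -> \bar R :=
  measure_extension product_premeasure.

HB.instance Definition _ := Measure.on iid.

Lemma iid_rect (A : nat -> set T) m : (forall k, measurable (A k)) ->
  iid [set x | forall k, (k < m)%N -> A k (x k)] =
  (\prod_(k < m) fine (P (A k)))%:E.
Proof.
move=> mA; pose B k := if (k < m)%N then A k else setT.
have mB k : measurable (B k) by rewrite /B; case: ifP.
have Bm k : (m <= k)%N -> B k = setT by rewrite /B ltnNge => ->.
have -> : [set x : stream T | forall k, (k < m)%N -> A k (x k)] = rect B.
  apply/seteqP; split => x Ax k; first by rewrite /B; case: ifP => // /Ax.
  by move=> km; have := Ax k; rewrite /B km.
transitivity (product_premeasure (rect B)).
  by rewrite /iid /measure_extension measurable_mu_extE//; exists B, m.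
rewrite (product_premeasureE mB Bm); congr (_%:E).
by apply: eq_bigr => k _; rewrite /B ltn_ord.
Qed.

Let iid_setT : iid setT = 1%E.
Proof.
have := @iid_rect (fun=> setT) 0 (fun=> measurableT).
by rewrite big_ord0 => <-; congr (iid _); apply/seteqP; split.
Qed.

HB.instance Definition _ := Measure_isProbability.Build _ _ _ iid iid_setT.

End product_premeasure.

Section hypothesis_selection.
Context (R : realType) d (T : measurableType d).

Definition dTV (P Q : probability T R) : \bar R :=
  ereal_sup [set `|P A - Q A|%E | A in measurable].

(* A sequential randomized algorithm with outputs in 'I_n: it draws a seed,
   then reads the samples x 0, x 1, ... one at a time. It stops after k samples
   when nsamples x r = Some k, and reads the whole stream when it is None; by
   output_prefix it decides to stop, and its output, on the prefix read. *)
Record algorithm n := Algorithm {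
  seed_display : measure_display ;
  seed : measurableType seed_display ;
  seed_law : probability seed R ;
  output : stream T -> seed -> 'I_n ;
  nsamples : stream T -> seed -> option nat ;
  measurable_output : forall i,
    measurable [set z : stream T * seed | output z.1 z.2 = i] ;
  measurable_nsamples : forall k,
    measurable [set z : stream T * seed | nsamples z.1 z.2 = Some k] ;
  output_prefix : forall x y r k, nsamples x r = Some k ->
    (forall j, (j < k)%N -> x j = y j) ->
    nsamples y r = Some k /\ output y r = output x r }.

Definition nsamplese n (A : algorithm n) (x : stream T) (r : seed A) : \bar R :=
  if nsamples x r is Some k then k%:R%:E else +oo%E.

Local Open Scope ereal_scope.

(* The two runs share the seed z.2 and use independent sample sequences. *)
Definition replicable n (rho : R) (A : algorithm n) :=
  forall P : probability T R,
    (1 - rho)%:E <= ((iid P \x iid P) \x seed_law A)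
      [set z | output z.1.1 z.2 = output z.1.2 z.2].

(* Whatever the sampled distribution, with probability at least 1 - delta the
   selected hypothesis is within C * OPT + eps of it. *)
Definition selects n (H : 'I_n -> probability T R) (C eps delta : R)
    (A : algorithm n) :=
  forall P : probability T R,
    (1 - delta)%:E <= (iid P \x seed_law A)
      [set z | dTV (H (output z.1 z.2)) P <=
               C%:E * (\big[mine/+oo]_(j < n) dTV (H j) P) + eps%:E].

Definition worst_case_samples n (A : algorithm n) (b : \bar R) :=
  forall x (r : seed A), nsamplese x r <= b.

Definition expected_samples n (A : algorithm n) (b : \bar R) :=
  forall P : probability T R,
    \int[iid P \x seed_law A]_z nsamplese z.1 z.2 <= b.

End hypothesis_selection.

(* Main.v *)
Require Import Defs.
From mathcomp Require Import all_boot all_order all_algebra.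
From mathcomp Require Import all_classical all_reals all_analysis.
From mathcomp Require Import measurable_realfun.
From mathcomp Require Import lra ring.
Import Order.TTheory GRing.Theory Num.Theory.
Import numFieldNormedType.Exports.
Local Open Scope ring_scope.

(* Score each hypothesis by its largest discrepancy with the empirical measure
   over the Scheffe sets of all pairs; minimizing this score exactly gives the
   factor 3. Perturb the scores by shared exponential noise of scale
   eta ~ eps / log n and output the minimizer (report-noisy-max). By
   memorylessness, the two smallest perturbed scores are within t of each other
   with probability at most t / eta, so runs with estimation error t disagree
   with probability O(t / eta).
     Samples are read in stages with geometrically decreasing margins theta_k,
   from eta down to about eta rho; the algorithm stops as soon as the leader
   wins by theta_k. Reaching stage k + 1 needs a near tie at scale theta_k, of
   probability O(theta_k / eta), which turns the worst case 1 / rho^2 into an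
   expected 1 / rho. A wrong stop needs a near tie at the scale of the excess
   max (0, 2 |empirical - P| - theta_k), whose expectation is theta_k times an
   exponentially small factor.
     When eps rho = 0 the bounds are infinite: the whole stream is read and the
   score is minimized exactly. *)

Set Implicit Arguments.
Unset Strict Implicit.
Unset Printing Implicit Defensive.

(** * Independent samples *)

(** Two runs may stop at different stages, so they are not compared with each other. Each is
    compared with the minimizer computed from the true masses of the Scheffe sets, which is a
    function of the shared seed alone; a disagreement then forces one run away from it. Sizes triple
    while margins halve. Up to constants, any growth factor strictly between 2 and 4 would do. Above
    2, the cost of reaching a stage, namely its size times the preceding margin, grows geometrically
    and the last stage dominates. Below 4, size times squared margin decreases along the stages, so
    the early stages, whose large margins would dominate the errors, have the smallest relative
    errors. The last size is about L / (eta rho)^2 with L of order log n and eta of order eps / L.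
    This is only a third power of log n, so the fifth power in the bound leaves room. *)

Section stream.
Context d (T : measurableType d).
Local Open Scope classical_set_scope.

Lemma measurable_coord k : measurable_fun setT (fun x : stream T => x k).
Proof.
move=> _ A mA; rewrite setTI; apply: sub_sigma_algebra.
exists (fun i => if i == k then A else setT), k.+1; split.
- by move=> i; case: ifP.
- by move=> i ki; rewrite gtn_eqF.
- apply/seteqP; split => [x Ax i|x /(_ k)]; last by rewrite eqxx.
  by case: eqP => // ->.
Qed.

Lemma measurable_fun_stream d' (X : measurableType d') (f : X -> stream T) :
  (forall k, measurable_fun setT (fun x => f x k)) -> measurable_fun setT f.
Proof.
move=> mf; apply: (@measurability _ _ X (stream T) setT f (@measurable _ (cylinders T))) => //.
move=> _ [_ [A [m [mA Am ->]] <-]].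
rewrite setTI (_ : f @^-1` _ = \bigcap_k ((fun x => f x k) @^-1` A k)).
  by apply: bigcapT_measurable => k; have := mf k measurableT _ (mA k); rewrite setTI.
by apply/seteqP; split => [x fA k _|x fA k]; exact: fA.
Qed.

(** One coordinate is isolated by overwriting it with a fresh draw rather than by splitting the
    stream into a product. The result is again a stream, so the operation can be iterated. *)
Definition resample i (z : stream T * T) : stream T :=
  fun k => if k == i then z.2 else z.1 k.

Lemma measurable_resample i : measurable_fun setT (resample i).
Proof.
apply: measurable_fun_stream => k; rewrite /resample; case: (k == i).
  exact: measurable_snd.
exact: (measurableT_comp (measurable_coord k) measurable_fst).
Qed.

End stream.

Section iid.
Context (R : realType) d (T : measurableType d) (P : probability T R).
Local Open Scope classical_set_scope.
Local Open Scope ereal_scope.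

Lemma iid_resample i (A : set (stream T)) : measurable A ->
  iid P A = (iid P \x P) (resample i @^-1` A).
Proof.
move=> mA.
pose nu : {measure set (stream T) -> \bar R} :=
  measure_function_pushforward__canonical__measure_function_Measure
    (iid P \x P) (measurable_resample (T := T) i).
apply: (@measure_unique _ R (stream T) (@measurable _ (cylinders T))
  (fun=> setT) _ _ _ _ (iid P) nu) => //.
- exact: rectangleI.
- by move=> _; exists (fun=> setT), 0%N; split => //; apply/seteqP; split.
- by rewrite bigcup_const//; exists 0%N.
- move=> ? [B [m [mB Bm ->]]].
  (* The horizon is enlarged to [maxn m i.+1] so that coordinate [i] is among the finitely many
     factors and can be pulled out of the product. *)
  have rE C : (forall k, (maxn m i.+1 <= k)%N -> C k = setT) ->
      rect C = [set x : stream T | forall k, (k < maxn m i.+1)%N -> C k (x k)].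
    move=> hC; apply/seteqP; split => [x Cx k _|x Cx k]; first exact: Cx.
    by have [km|/hC->//] := ltnP k (maxn m i.+1); exact: Cx.
  have hB k : (maxn m i.+1 <= k)%N -> B k = setT.
    by rewrite geq_max => /andP[/Bm].
  pose B' k := if k == i then setT else B k.
  have hB' k : (maxn m i.+1 <= k)%N -> B' k = setT.
    by move=> km; rewrite /B' hB//; case: ifP.
  have mB' k : measurable (B' k) by rewrite /B'; case: ifP.
  rewrite /nu/= /pushforward.
  rewrite (_ : _ @^-1` rect B = rect B' `*` B i); last first.
    apply/seteqP; split => [[x t]/= xB|[x t]/= [xB tB] k].
      split; last by have := xB i; rewrite /resample eqxx.
      by move=> k; have := xB k; rewrite /resample /B'; case: eqP.
    by have := xB k; rewrite /resample /B'; case: eqP => // ->.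
  rewrite product_measure1E//; last first.
    by apply: sub_sigma_algebra; exists B', (maxn m i.+1); split.
  have eB C : (forall k, measurable (C k)) ->
      (forall k, (maxn m i.+1 <= k)%N -> C k = setT) ->
      iid P (rect C) = (\prod_(k < maxn m i.+1) fine (P (C k)))%:E.
    by move=> mC hC; rewrite (rE _ hC); exact: iid_rect.
  rewrite [LHS]eB// [X in _ = X * _]eB//.
  have im : (i < maxn m i.+1)%N by rewrite leq_max ltnSn orbT.
  rewrite (bigD1 (Ordinal im))//= [in RHS](bigD1 (Ordinal im))//=.
  rewrite {1}/B' eqxx probability_setT mul1r muleC EFinM.
  rewrite fineK ?fin_num_measure//; congr (_ * _%:E).
  by apply: eq_bigr => j; rewrite -val_eqE/= /B' => /negbTE ->.
- by move=> k; rewrite (le_lt_trans (probability_le1 _ _))// ltry.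
Qed.

Lemma integral_resample i (f : stream T -> \bar R) :
  measurable_fun setT f -> (forall x, 0 <= f x) ->
  \int[iid P]_x f x = \int[iid P]_x \int[P]_t f (resample i (x, t)).
Proof.
move=> mf f0.
transitivity (\int[pushforward (iid P \x P) (resample i)]_x f x).
  apply: eq_measure_integral => [|? A mA _]; first exact: measurable_resample.
  exact: (iid_resample i mA).
rewrite ge0_integral_pushforward//; last exact: measurable_resample.
rewrite preimage_setT fubini_tonelli1//.
  exact: (measurableT_comp mf (measurable_resample i)).
by move=> z; exact: f0.
Qed.

(** Induction on [m], resampling coordinate [m]: the earlier factors do not see the fresh draw and
    leave the inner integral. *)
Lemma integral_prod_coord (g : T -> R) m : measurable_fun setT g ->
  (forall t, 0 <= g t)%R -> \int[P]_t (g t)%:E \is a fin_num ->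
  \int[iid P]_x (\prod_(j < m) g (x j))%:E = (\int[P]_t (g t)%:E) ^+ m.
Proof.
move=> mg g0 fg; elim: m => [|m IH].
  under eq_integral do rewrite big_ord0.
  by rewrite integral_cst// mul1e expe0; exact: probability_setT.
have mp k : measurable_fun setT (fun x : stream T => (\prod_(j < k) g (x j))%:E).
  apply/measurable_EFinP; apply: measurable_prod => j _.
  exact: (measurableT_comp mg (measurable_coord j)).
rewrite (integral_resample m)//; last first.
  by move=> x; rewrite lee_fin prodr_ge0.
transitivity (\int[iid P]_x ((\prod_(j < m) g (x j))%:E * \int[P]_t (g t)%:E)).
  apply: eq_integral => x _; rewrite -ge0_integralZl//; first last.
  - by rewrite lee_fin prodr_ge0.
  - by move=> t _; rewrite lee_fin.
  - exact/measurable_EFinP.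
  apply: eq_integral => t _; rewrite big_ord_recr/= /resample eqxx EFinM/=.
  by congr (_%:E * _); apply: eq_bigr => j _; rewrite ltn_eqF.
rewrite -(fineK fg) ge0_integralZr//; first last.
- by rewrite lee_fin fine_ge0// integral_ge0// => t _; rewrite lee_fin.
- by move=> x _; rewrite lee_fin prodr_ge0.
- by rewrite IH fineK// expeS muleC.
Qed.

End iid.

(** * Concentration of empirical frequencies *)

Section concentration.
Context (R : realType) d (T : measurableType d).
Local Open Scope classical_set_scope.

(** From exp(- y) >= 1 - y one gets exp y <= 1 / (1 - y), and (1 - y) (1 + y + 2 y^2) = 1 + y^2 (1 -
    2 y) >= 1. *)
Lemma expR_le_quadratic (y : R) : y <= 2^-1 -> expR y <= 1 + y + 2 * y ^+ 2.
Proof.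
move=> y2; have e0 := expR_gt0 y.
have e1 : (1 - y) * expR y <= 1.
  have := expR_ge1Dx (- y); rewrite expRN => h.
  by rewrite -ler_pdivlMr// div1r.
rewrite -(ler_pM2l (_ : 0 < 1 - y)); last by lra.
apply: (le_trans e1); have : 0 <= y ^+ 2 by exact: sqr_ge0.
nra.
Qed.

Definition empirical m (S : set T) (x : stream T) : R :=
  (\sum_(j < m) \1_S (x j)) / m%:R.

Lemma measurable_empirical m S : measurable S ->
  measurable_fun setT (empirical m S).
Proof.
move=> mS; apply: measurable_funM => //; apply: measurable_sum => j.
exact: (measurableT_comp (measurable_indic mS) (measurable_coord j)).
Qed.

Lemma empirical_ge0 m S x : 0 <= empirical m S x.
Proof. by rewrite divr_ge0 ?sumr_ge0. Qed.

Lemma empirical_le1 m S x : empirical m S x <= 1.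
Proof.
rewrite /empirical; case: m => [|m]; first by rewrite big_ord0 mul0r.
rewrite ler_pdivrMr// mul1r.
have -> : m.+1%:R = \sum_(j < m.+1) 1 :> R by rewrite sumr_const card_ord.
by rewrite ler_sum.
Qed.

Lemma empirical_prefix m S (x y : stream T) :
  (forall j, (j < m)%N -> x j = y j) -> empirical m S x = empirical m S y.
Proof.
by move=> xy; congr (_ / _); apply: eq_bigr => j _; rewrite xy.
Qed.

Variable P : probability T R.

Definition deviation m S x := empirical m S x - fine (P S).

Lemma measurable_deviation m S : measurable S ->
  measurable_fun setT (deviation m S).
Proof. by move=> mS; apply: measurable_funB => //; exact: measurable_empirical. Qed.

(** The centered indicator has two values, so the integral is p A + (1 - p) B. In the quadratic
    bounds on A and B the linear terms cancel and 1 + 2 a^2 p (1 - p) remains. *)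
Lemma mgf_indic (S : set T) (a : R) : measurable S -> `|a| <= 2^-1 ->
  (\int[P]_t (expR (a * (\1_S t - fine (P S))))%:E <= (expR (2 * a ^+ 2))%:E)%E.
Proof.
move=> mS ha; set p := fine (P S).
have pE : P S = p%:E by rewrite fineK// fin_num_measure.
have p0 : 0 <= p by exact: fine_ge0.
have p1 : p <= 1 by rewrite -lee_fin -pE probability_le1.
pose A := expR (a * (1 - p)); pose B := expR (a * (0 - p)).
have -> : (\int[P]_t (expR (a * (\1_S t - p)))%:E =
    \int[P]_t (A%:E * (\1_S t)%:E + B%:E * (\1_(~` S) t)%:E))%E.
  apply: eq_integral => t _.
  rewrite !indicE in_setC /A /B.
  by case: (t \in S); rewrite /= ?mule1 ?mule0 ?adde0 ?add0e.
have mI (S' : set T) : measurable S' -> measurable_fun setT (fun t => (\1_S' t : R)%:E).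
  by move=> mS'; apply/measurable_EFinP; exact: measurable_indic.
have hI (c : R) (S' : set T) : 0 <= c -> measurable S' ->
    (\int[P]_t (c%:E * (\1_S' t)%:E) = c%:E * P S')%E.
  move=> c0 mS'; rewrite ge0_integralZl_EFin//; last exact: mI.
  by rewrite integral_indic// setIT.
have mS'' := measurableC mS.
rewrite ge0_integralD//=; last 4 first.
- by move=> t _; rewrite mule_ge0 ?lee_fin ?expR_ge0.
- by apply: measurable_funeM; exact: mI.
- by move=> t _; rewrite mule_ge0 ?lee_fin ?expR_ge0.
- by apply: measurable_funeM; exact: mI.
rewrite !hI ?expR_ge0//.
rewrite probability_setC// pE -EFinB -!EFinM -EFinD lee_fin.
move: ha; rewrite ler_norml => /andP[a1 a2].
have hA : A <= 1 + a * (1 - p) + 2 * (a * (1 - p)) ^+ 2.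
  by apply: expR_le_quadratic; nra.
have hB : B <= 1 + a * (0 - p) + 2 * (a * (0 - p)) ^+ 2.
  by apply: expR_le_quadratic; nra.
have hE := expR_ge1Dx (2 * a ^+ 2).
have a0 : 0 <= a ^+ 2 by exact: sqr_ge0.
apply: le_trans hE.
apply: (@le_trans _ _ (1 + 2 * a ^+ 2 * (p * (1 - p)))); last first.
  by rewrite lerD2l ler_piMr//; nra.
have h1 := ler_wpM2r p0 hA.
have h2 : B * (1 - p) <= (1 + a * (0 - p) + 2 * (a * (0 - p)) ^+ 2) * (1 - p).
  by apply: ler_wpM2r => //; lra.
apply: (le_trans (lerD h1 h2)).
by rewrite le_eqVlt; apply/orP; left; apply/eqP; ring.
Qed.

(** The hypothesis on [s] keeps the parameter [s / m] of each sample in the range of [mgf_indic]. *)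
Lemma mgf_deviation m (S : set T) (s : R) : measurable S -> (0 < m)%N ->
  `|s| <= m%:R / 2 ->
  (\int[iid P]_x (expR (s * deviation m S x))%:E <= (expR (2 * s ^+ 2 / m%:R))%:E)%E.
Proof.
move=> mS m0 hs; have m0R : 0 < m%:R :> R by rewrite ltr0n.
pose a := s / m%:R; pose g t := expR (a * (\1_S t - fine (P S))).
have mg : measurable_fun setT g.
  apply: measurableT_comp => //; apply: measurable_funM => //.
  by apply: measurable_funB => //; exact: measurable_indic.
have g0 t : 0 <= g t by exact: expR_ge0.
have ha : `|a| <= 2^-1.
  by rewrite normrM (ger0_norm (_ : 0 <= m%:R^-1))// ler_pdivrMr// mulrC.
have hg := mgf_indic mS ha.
have ig0 : (0 <= \int[P]_t (g t)%:E)%E by apply: integral_ge0 => t _; rewrite lee_fin.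
have fg : (\int[P]_t (g t)%:E)%E \is a fin_num.
  by rewrite ge0_fin_numE// (le_lt_trans hg)// ltry.
under eq_integral => x _.
  have -> : expR (s * deviation m S x) = \prod_(j < m) g (x j).
    rewrite /g -expR_sum -mulr_sumr /a -mulrA; congr (expR (s * _)).
    rewrite sumrB sumr_const card_ord /deviation /empirical -mulr_natl.
    by field; rewrite gt_eqF.
  over.
rewrite integral_prod_coord//.
apply: (@le_trans _ _ ((expR (2 * a ^+ 2))%:E ^+ m)%E).
  rewrite -(fineK fg) -!EFin_expe lee_fin lerXn2r ?nnegrE ?expR_ge0 ?fine_ge0//.
  by rewrite -lee_fin fineK.
rewrite -EFin_expe lee_fin -expRM_natl ler_expR /a le_eqVlt; apply/orP; left.
by apply/eqP; field; rewrite gt_eqF.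
Qed.

(** Comparing two costs incurs the estimation error once on each side, hence the factor 2. Only the
    part that the margin [theta] fails to absorb is kept. *)
Definition excess m (theta : R) S x : R :=
  Num.max 0 (2 * `|deviation m S x| - theta).

Lemma measurable_excess m theta S : measurable S ->
  measurable_fun setT (excess m theta S).
Proof.
move=> mS; apply: measurable_maxr => //; apply: measurable_funB => //.
apply: measurable_funM => //; apply: measurableT_comp => //.
exact: measurable_deviation.
Qed.

Lemma excess_ge0 m theta S x : 0 <= excess m theta S x.
Proof. by rewrite le_max lexx. Qed.

(** Exponential Markov for an expectation: u <= exp(t u) / t with u = 2 |D| - theta, where exp(2 t
    |D|) is at most the sum of the exponentials with both signs of D. *)
Lemma integral_excess m theta S : measurable S -> 0 < theta <= 1 ->
  32 <= m%:R * theta ^+ 2 ->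
  (\int[iid P]_x (excess m theta S x)%:E <=
   (theta * expR (- (m%:R * theta ^+ 2 / 32)))%:E)%E.
Proof.
move=> mS /andP[t0 t1] h32.
have m0 : (0 < m)%N.
  by rewrite lt0n; apply/eqP => m0; move: h32; rewrite m0 mul0r; lra.
have m0R : 0 < m%:R :> R by rewrite ltr0n.
(* This [t] minimizes the exponent - t theta + 8 t^2 / m. The prefactor 2 / t = 32 / (m theta) is at
   most theta exactly by hypothesis [h32]. *)
pose t : R := m%:R * theta / 16; have tp : 0 < t by rewrite /t; nra.
pose c := t^-1 * expR (- (t * theta)).
have c0 : 0 <= c by rewrite mulr_ge0 ?expR_ge0// invr_ge0 ltW.
have mE (s : R) : measurable_fun setT (fun x => (expR (s * deviation m S x))%:E).
  apply/measurable_EFinP; apply: measurableT_comp => //.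
  by apply: measurable_funM => //; exact: measurable_deviation.
apply: (@le_trans _ _ (\int[iid P]_x (c%:E * ((expR (2 * t * deviation m S x))%:E
   + (expR (- (2 * t) * deviation m S x))%:E)))%E).
  apply: ge0_le_integral => //=.
  - by move=> x _; rewrite lee_fin excess_ge0.
  - by apply/measurable_EFinP; exact: measurable_excess.
  - by apply: measurable_funeM; apply: emeasurable_funD.
  move=> x _; rewrite -EFinD -EFinM lee_fin /excess ge_max; apply/andP; split.
    by rewrite mulr_ge0// addr_ge0// expR_ge0.
  set D := deviation m S x.
  have e1 : expR (2 * t * `|D|) <= expR (2 * t * D) + expR (- (2 * t) * D).
    rewrite mulNr; have [D0|D0] := lerP 0 D.
      by rewrite ger0_norm// lerDl expR_ge0.
    by rewrite ltr0_norm// mulrN lerDr expR_ge0.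
  apply: (@le_trans _ _ (c * expR (2 * t * `|D|))); last by rewrite ler_wpM2l.
  rewrite /c -mulrA -expRD ler_pdivlMl//.
  have := expR_ge1Dx (- (t * theta) + 2 * t * `|D|); lra.
rewrite ge0_integralZl//=; last 2 first.
- by apply: emeasurable_funD.
- by move=> x _; rewrite adde_ge0// lee_fin expR_ge0.
rewrite ge0_integralD//=; try by move=> x _; rewrite lee_fin expR_ge0.
have b1 : (\int[iid P]_x (expR (2 * t * deviation m S x))%:E <=
           (expR (2 * (2 * t) ^+ 2 / m%:R))%:E)%E.
  by apply: mgf_deviation => //; rewrite ger0_norm /t; nra.
have b2 : (\int[iid P]_x (expR (- (2 * t) * deviation m S x))%:E <=
           (expR (2 * (2 * t) ^+ 2 / m%:R))%:E)%E.
  rewrite -(sqrrN (2 * t)).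
  by apply: mgf_deviation => //; rewrite normrN ger0_norm /t; nra.
apply: (@le_trans _ _ (c%:E * ((expR (2 * (2 * t) ^+ 2 / m%:R))%:E +
   (expR (2 * (2 * t) ^+ 2 / m%:R))%:E))%E).
  by apply: lee_wpmul2l => //; exact: leeD.
rewrite -EFinD -EFinM lee_fin /c; set E := expR (2 * _ / _).
have -> : t^-1 * expR (- (t * theta)) * (E + E) =
    2 * t^-1 * (expR (- (t * theta)) * E) by ring.
rewrite /E -expRD.
have -> : - (t * theta) + 2 * (2 * t) ^+ 2 / m%:R = - (m%:R * theta ^+ 2 / 32).
  by rewrite /t; field; rewrite gt_eqF.
rewrite ler_wpM2r ?expR_ge0// /t.
have -> : 2 * (m%:R * theta / 16)^-1 = 32 / (m%:R * theta) :> R.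
  by field; rewrite !gt_eqF.
rewrite ler_pdivrMr; last by nra.
nra.
Qed.

End concentration.

(** * Exponential noise and near ties *)

Section finite_measurability.
Context d (T : measurableType d).
Local Open Scope classical_set_scope.

Lemma measurable_forall (I : finType) (A : I -> T -> Prop) :
  (forall i, measurable [set x | A i x]) -> measurable [set x | forall i, A i x].
Proof.
move=> mA; rewrite (_ : [set x | _] = \bigcap_(i in setT) [set x | A i x]).
  by apply: fin_bigcap_measurable => //; exact: finite_finset.
by apply/seteqP; split => [x Ax i _|x Ax i]; exact: Ax.
Qed.

Lemma measurable_exists (I : finType) (A : I -> T -> Prop) :
  (forall i, measurable [set x | A i x]) -> measurable [set x | exists i, A i x].
Proof.
move=> mA; rewrite (_ : [set x | _] = \bigcup_(i in setT) [set x | A i x]).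
  by apply: fin_bigcup_measurable => //; exact: finite_finset.
by apply/seteqP; split => [x [i Ax]|x [i _ Ax]]; exists i.
Qed.

Lemma measurable_and2 (A B : T -> Prop) : measurable [set x | A x] ->
  measurable [set x | B x] -> measurable [set x | A x /\ B x].
Proof. exact: measurableI. Qed.

Lemma measurable_constprop (A : Prop) : measurable [set _ : T | A].
Proof.
have [a|na] := pselect A.
  by rewrite (_ : [set _ | _] = setT)//; apply/seteqP; split.
by rewrite (_ : [set _ | _] = set0)//; apply/seteqP; split.
Qed.

Lemma measurable_imply (A : Prop) (B : T -> Prop) : measurable [set x | B x] ->
  measurable [set x | A -> B x].
Proof.
move=> mB; have [a|na] := pselect A.
  rewrite (_ : [set x | _] = [set x | B x])//.
  by apply/seteqP; split => x /=; [exact|].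
by rewrite (_ : [set x | _] = setT)//; apply/seteqP; split => // x _ /na.
Qed.

Lemma measurable_boolP (b : T -> bool) : measurable [set x | b x] ->
  forall c : bool, measurable [set x | b x = c].
Proof.
move=> mb [] //; rewrite (_ : [set x | _] = ~` [set x | b x]); first exact: measurableC.
by apply/seteqP; split => x /=; [move=> ->|move/negP/negbTE].
Qed.

(** Quantifying over the finitely many truth tables [phi] removes any requirement on [Q]. This gives
    the measurability of [argmin] and of the stopping stage. *)
Lemma measurable_finfun_bool (I : finType) (b : T -> I -> bool)
    (Q : {ffun I -> bool} -> Prop) :
  (forall i, measurable [set x | b x i]) ->
  measurable [set x | Q [ffun i => b x i]].
Proof.
move=> mb; rewrite (_ : [set x | _] =
    [set x | exists phi : {ffun I -> bool}, Q phi /\ forall i, b x i = phi i]).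
  apply: measurable_exists => phi; apply: measurable_and2.
    exact: measurable_constprop.
  by apply: measurable_forall => i; exact: measurable_boolP.
apply/seteqP; split => x /=.
  by move=> Qx; exists [ffun i => b x i]; split => // i; rewrite ffunE.
move=> [phi [Qphi bphi]]; rewrite (_ : [ffun i => b x i] = phi)//.
by apply/ffunP => i; rewrite ffunE.
Qed.

Context (R : realType).

Lemma measurable_le_set (f g : T -> R) : measurable_fun setT f ->
  measurable_fun setT g -> measurable [set x | f x <= g x].
Proof.
move=> mf mg; have := measurable_fun_ler mf mg measurableT (Y := [set true]).
by rewrite setTI; exact.
Qed.

Lemma measurable_lt_set (f g : T -> R) : measurable_fun setT f ->
  measurable_fun setT g -> measurable [set x | f x < g x].
Proof.
move=> mf mg; have := measurable_fun_ltr mf mg measurableT (Y := [set true]).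
by rewrite setTI; exact.
Qed.

Local Open Scope ereal_scope.

Lemma measure_union_bound (mu : {measure set T -> \bar R}) (I : finType)
    (F : I -> set T) (A : set T) : measurable A ->
  (forall i, measurable (F i)) -> (forall x, A x -> exists i, F i x) ->
  mu A <= \sum_(i : I) mu (F i).
Proof.
move=> mA mF AF.
apply: (@le_trans _ _ (mu (\big[setU/set0]_(i : I) F i))).
  rewrite le_measure ?inE//; first exact: bigsetU_measurable.
  move=> x /AF[i Fx]; rewrite -bigcup_seq; exists i => //=.
  by rewrite mem_index_enum.
elim: (index_enum I) => [|i s IH]; first by rewrite !big_nil measure0.
rewrite !big_cons (le_trans (measureU2 _ _ _))//; last exact: leeD.
exact: bigsetU_measurable.
Qed.

End finite_measurability.

Section disjoint_sum.
Context (R : realType) d (T : measurableType d) (P : probability T R).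
Local Open Scope classical_set_scope.
Local Open Scope ereal_scope.

Lemma disjoint_sum_le1 (I : finType) (F : I -> set T) :
  (forall i, measurable (F i)) -> (forall i j x, F i x -> F j x -> i = j) ->
  \sum_(i : I) P (F i) <= 1.
Proof.
move=> mF dF.
have -> : \sum_(i : I) P (F i) = P (\big[setU/set0]_(i : I) F i).
  elim: (index_enum I) (index_enum_uniq I) => [|i s IH].
    by rewrite !big_nil measure0.
  rewrite cons_uniq => /andP[iNs us]; rewrite !big_cons IH// measureU//.
    exact: bigsetU_measurable.
  rewrite -bigcup_seq; apply/seteqP; split => // x [Fi [j /= js Fj]].
  by move: iNs; rewrite (dF _ _ _ Fi Fj) js.
exact/probability_le1/bigsetU_measurable.
Qed.

End disjoint_sum.

Section exponential_law.
Context (R : realType).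
Local Open Scope classical_set_scope.

Definition exp_law : probability (measurableTypeR R) R :=
  exponential_distribution_exponential_prob__canonical__probability_measure_Probability
    (ltr01 : 0 < 1 :> R).

Lemma exp_law_neg (A : set R) : (forall u, A u -> u < 0) -> exp_law A = 0%E.
Proof.
move=> A0; apply: integral0_eq => u /A0 u0.
by rewrite lt0_exponential_pdf.
Qed.

Lemma exp_law_set1 (x : R) : exp_law [set x] = 0%E.
Proof. exact: integral_set1. Qed.

Lemma measurable_le_const (x : R) : measurable ([set u | u <= x] : set (measurableTypeR R)).
Proof. by rewrite -set_itvNyc; exact: measurable_itv. Qed.

Lemma measurable_lt_le_const (x y : R) :
  measurable ([set u | x < u <= y] : set (measurableTypeR R)).
Proof. by rewrite -set_itvoc; exact: measurable_itv. Qed.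

Lemma exp_law_cdf (x : R) :
  exp_law [set u | u <= x] = (1 - expR (- Num.max 0 x))%:E.
Proof.
have neg0 : exp_law `]-oo, 0[ = 0%E.
  by apply: exp_law_neg => u /=; rewrite in_itv.
have [x0|x0|->] := ltgtP x 0.
- rewrite exp_law_neg ?oppr0 ?expR0 ?subrr// => u /=.
  by move/le_lt_trans; exact.
- rewrite (_ : [set u | u <= x] = `]-oo, 0[ `|` `[0, x]); last first.
    apply/seteqP; split => u /=; rewrite !in_itv/=.
      by move=> ux; have [|] := ltP u 0; [left|right; rewrite ux].
    by move=> [u0|/andP[]//]; rewrite ltW// (lt_trans u0).
  rewrite measureU//=.
    rewrite neg0 add0e [LHS]exponential_prob_itv0c// mulN1r EFinB.
    by [].
  by apply/seteqP; split => // u /=; rewrite !in_itv/= ltNge => -[/negP + /andP[]].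
- rewrite (_ : [set u | u <= 0] = `]-oo, 0[ `|` [set 0]); last first.
    apply/seteqP; split => u /=; rewrite !in_itv/=.
      by rewrite le_eqVlt => /orP[/eqP|]; [right|left].
    by move=> [/ltW//|->].
  rewrite measureU//=.
    by rewrite neg0 exp_law_set1 oppr0 expR0 subrr adde0.
  by apply/seteqP; split => // u /=; rewrite !in_itv/= => -[+ u0]; rewrite u0 ltxx.
Qed.

Lemma exp_lawU (A B : set (measurableTypeR R)) : measurable A -> measurable B ->
  A `&` B = set0 -> (exp_law (A `|` B) = exp_law A + exp_law B)%E.
Proof. exact: measureU. Qed.

(* Memorylessness: given u > x, the excess u - x lies in [0, t] with probability
   at most t. *)
Lemma exp_law_window (x t : R) : 0 <= t ->
  (exp_law [set u | (x <= u <= x + t)%R] <= t%:E * exp_law [set u | (x < u)%R])%E.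
Proof.
move=> t0.
have -> : exp_law [set u | x < u] = (expR (- Num.max 0 x))%:E.
  rewrite (_ : [set u | x < u] = ~` [set u | u <= x]); last first.
    by apply/seteqP; split => u /=; rewrite ltNge => /negP.
  rewrite probability_setC; last exact: measurable_le_const.
  by rewrite exp_law_cdf -EFinB opprB addrC subrK.
have e1 : exp_law [set u | x <= u <= x + t] = exp_law [set u | x < u <= x + t].
  rewrite (_ : [set u | x <= u <= x + t] =
      [set x] `|` [set u | x < u <= x + t]); last first.
    apply/seteqP; split => u /=.
      by move=> /andP[+ ->]; rewrite le_eqVlt => /orP[/eqP|]; [left|right; rewrite andbT].
    by move=> [->|/andP[/ltW-> ->//]]; rewrite lexx lerDl.
  rewrite measureU//=; try exact: measurable_lt_le_const.
    by rewrite exp_law_set1 add0e.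
  by apply/seteqP; split => // u /= [->]; rewrite ltxx.
have := exp_law_cdf (x + t).
rewrite (_ : [set u | u <= x + t] = [set u | u <= x] `|` [set u | x < u <= x + t]).
  rewrite exp_lawU//; try exact: measurable_lt_le_const; try exact: measurable_le_const.
    rewrite e1 exp_law_cdf; set W := exp_law [set u | x < u <= x + t].
    have Wf : W \is a fin_num.
      by rewrite /W fin_num_measure//; exact: measurable_lt_le_const.
    rewrite -(fineK Wf) -EFinM lee_fin.
    (* Truncation at 0, where the density starts, does not increase distances, so b - a <= t; then 1
       - exp(- (b - a)) <= b - a. *)
    set a := Num.max 0 x; set b := Num.max 0 (x + t) => eW.
    have := congr1 fine eW : 1 - expR (- a) + fine W = 1 - expR (- b).
    have -> : expR (- b) = expR (- a) * expR (- (b - a)).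
      by rewrite -expRD; congr expR; ring.
    have h := expR_ge1Dx (- (b - a)); have ea := expR_gt0 (- a).
    have bat : b - a <= t.
      by rewrite /a /b; case: (lerP 0 x); case: (lerP 0 (x + t)) => *; lra.
    move=> hW; apply: (@le_trans _ _ (expR (- a) * (1 - expR (- (b - a))))).
      by lra.
    rewrite [leRHS]mulrC ler_pM2l//; lra.
  by apply/seteqP; split => // u /= [ux /andP[]]; rewrite ltNge ux.
apply/seteqP; split => u /=.
  by move=> uxt; have [|] := leP u x; [left|right].
by move=> [ux|/andP[]//]; rewrite (le_trans ux)// lerDl.
Qed.

(** Noise is subtracted and the minimum taken, so an index wins when its own noise exceeds a
    threshold: this is the upper tail, where the exponential law is memoryless. *)
Definition near_tie n (v : 'I_n -> R) (t : R) (r : nat -> R) := exists i j : 'I_n,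
  [/\ i != j, forall l : 'I_n, v i - r i <= v l - r l & v j - r j <= v i - r i + t].

(* Freezing all coordinates but i, the near tie at i is a window of length t
   above the threshold beyond which i is the unique minimizer; the latter events
   are disjoint over i, so no factor n is lost. *)
Lemma iid_near_tie n (v : 'I_n -> R) (t : R) : 0 <= t ->
  (iid exp_law [set r | near_tie v t r] <= t%:E)%E.
Proof.
move=> t0.
pose G (i : 'I_n) := [set r : stream (measurableTypeR R) |
  (forall l : 'I_n, v i - r i <= v l - r l) /\
  exists j : 'I_n, j != i /\ v j - r j <= v i - r i + t].
pose M (i : 'I_n) := [set r : stream (measurableTypeR R) |
  forall l : 'I_n, l != i -> v i - r i < v l - r l].
have mv (i : 'I_n) : measurable_fun setT
    (fun r : stream (measurableTypeR R) => v i - r i : R).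
  by apply: measurable_funB => //; exact: measurable_coord.
have mG i : measurable (G i).
  apply: measurable_and2; first by apply: measurable_forall => l; exact: measurable_le_set.
  apply: measurable_exists => j; apply: measurable_and2; first exact: measurable_constprop.
  by apply: measurable_le_set => //; exact: measurable_funD.
have mM i : measurable (M i).
  apply: measurable_forall => l; apply: measurable_imply.
  exact: measurable_lt_set.
have GM i : (iid exp_law (G i) <= t%:E * iid exp_law (M i))%E.
  have mrG : measurable (resample i @^-1` G i).
    by rewrite -[X in measurable X]setTI; exact: measurable_resample.
  have mrM : measurable (resample i @^-1` M i).
    by rewrite -[X in measurable X]setTI; exact: measurable_resample.
  have key x : (exp_law (xsection (resample i @^-1` G i) x) <=
      t%:E * exp_law (xsection (resample i @^-1` M i) x))%E.
    have [j1 /= ji|none] := pickP (fun j => j != i); last first.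
      rewrite (_ : xsection (resample i @^-1` G i) x = set0).
        by rewrite measure0; apply: mule_ge0; rewrite ?lee_fin.
      apply/seteqP; split => // u; rewrite /xsection/= inE => -[_ [j [ji _]]].
      by have := none j; rewrite ji.
    case: (@Order.TotalTheory.arg_minP _ _ _ j1 (fun j => j != i) (fun j => v j - x j) ji) => j0 j0i j0min.
    apply: (@le_trans _ _ (exp_law [set u : R | v i - (v j0 - x j0) <= u <= v i - (v j0 - x j0) + t])).
      rewrite le_measure ?inE//; first exact: measurable_xsection.
        by rewrite -set_itvcc; exact: measurable_itv.
      move=> u; rewrite /xsection/= inE => -[h [j [ji' hj]]].
      have := h j0; have := j0min _ ji'; move: hj.
      have e1 : (j == i :> nat) = false := negbTE ji'.
      have e2 : (j0 == i :> nat) = false := negbTE j0i.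
      by rewrite /resample/= eqxx e1 e2 => *; lra.
    apply: (le_trans (exp_law_window _ t0)); apply: lee_wpmul2l => //.
    rewrite le_measure ?inE//; [|exact: measurable_xsection|].
      by rewrite -set_itvoy; exact: measurable_itv.
    move=> u /= hu; rewrite /xsection/= inE => l li.
    have := j0min _ li.
    have e1 : (l == i :> nat) = false := negbTE li.
    by rewrite /resample/= eqxx e1 => *; lra.
  rewrite (iid_resample exp_law i (mG i)) (iid_resample exp_law i (mM i)).
  rewrite /product_measure1 -ge0_integralZl//; last exact: measurable_fun_xsection.
  apply: ge0_le_integral => //.
  - exact: measurable_fun_xsection.
  - by apply: measurable_funeM; exact: measurable_fun_xsection.
  by move=> x _; exact: key.
have mN : measurable [set r : stream (measurableTypeR R) | near_tie v t r].
  rewrite (_ : [set r | _] = [set r | exists i, G i r]); first exact: measurable_exists.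
  apply/seteqP; split => r /=.
    by move=> [i [j [ij h1 h2]]]; exists i; split => //; exists j; rewrite eq_sym.
  by move=> [i [h1 [j [ij h2]]]]; exists i, j; rewrite eq_sym.
apply: (@le_trans _ _ (\sum_(i < n) iid exp_law (G i))%E).
  apply: measure_union_bound => // r [i [j [ij h1 h2]]].
  by exists i; split => //; exists j; rewrite eq_sym.
apply: (@le_trans _ _ (\sum_(i < n) t%:E * iid exp_law (M i))%E).
  by apply: lee_sum => i _; exact: GM.
rewrite -ge0_sume_distrr//.
rewrite -[leRHS]mule1; apply: lee_wpmul2l => //.
apply: disjoint_sum_le1 => // i j r Mi Mj.
apply/eqP; apply: contraT => ij.
have := Mi j; rewrite eq_sym ij => /(_ isT); have := Mj i ij; lra.
Qed.

(** Used for accuracy: off this event the noise shifts a comparison of scores by at most [eta * U].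
    Negative values are null for the law but possible for a seed, so the event includes them. *)
Lemma iid_exp_range n (U : R) : 0 < U ->
  (iid exp_law [set r | exists i : 'I_n, ~~ (0 <= (r : nat -> R) i <= U)%R] <=
   (n%:R * expR (- U))%:E)%E.
Proof.
move=> U0.
pose F (i : 'I_n) := [set r : stream (measurableTypeR R) | ~~ (0 <= r i <= U)%R].
pose B : set (measurableTypeR R) := ~` `[0, U].
have mB : measurable B by apply: measurableC; exact: measurable_itv.
have eB : exp_law B = (expR (- U))%:E.
  rewrite probability_setC; last exact: measurable_itv.
  rewrite [X in (_ - X)%E]exponential_prob_itv0c// mulN1r -EFinB.
  by rewrite opprB addrC subrK.
have FB i : F i = (fun r : stream (measurableTypeR R) => r i) @^-1` B.
  by apply/seteqP; split => r /=; rewrite /F /B /= in_itv/= => /negP.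
have mF i : measurable (F i).
  by rewrite FB -[X in measurable X]setTI; exact: measurable_coord.
apply: (@le_trans _ _ (\sum_(i < n) iid exp_law (F i))%E).
  by apply: measure_union_bound => //; exact: measurable_exists.
have -> : n%:R * expR (- U) = \sum_(i < n) expR (- U).
  by rewrite sumr_const card_ord mulr_natl.
rewrite -sumEFin; apply: lee_sum => i _.
rewrite (iid_resample exp_law i (mF i)).
rewrite (_ : _ @^-1` _ = setT `*` B); last first.
  rewrite FB; apply/seteqP; split => [[x u]|[x u]] /=; rewrite /resample eqxx//.
  by move=> [].
rewrite product_measure1E// [X in (X * _)%E](_ : _ = 1%E) ?mul1e; last exact: probability_setT.
by rewrite le_eqVlt; apply/orP; left; apply/eqP; exact: eB.
Qed.

End exponential_law.

(** * Scheffe sets and the minimum distance score *)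

Section total_variation.
Context (R : realType) d (T : measurableType d).
Local Open Scope classical_set_scope.
Implicit Types P Q : probability T R.

Lemma probability_fineK P (A : set T) : measurable A -> (fine (P A))%:E = P A.
Proof. by move=> mA; rewrite fineK// fin_num_measure. Qed.

Lemma dTV_ge P Q (A : set T) : measurable A ->
  (`|fine (P A) - fine (Q A)|%:E <= dTV P Q)%E.
Proof.
move=> mA; apply: ereal_sup_ubound; exists A => //.
by rewrite -(probability_fineK P mA) -(probability_fineK Q mA).
Qed.

Lemma dTV_le P Q (c : R) :
  (forall A, measurable A -> `|fine (P A) - fine (Q A)| <= c) ->
  (dTV P Q <= c%:E)%E.
Proof.
move=> h; apply: ge_ereal_sup => _ [A mA <-].
rewrite -(probability_fineK P mA) -(probability_fineK Q mA).
by rewrite -EFinB abse_EFin lee_fin h.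
Qed.

Lemma fine_probability01 P (A : set T) : measurable A -> 0 <= fine (P A) <= 1.
Proof.
move=> mA; rewrite fine_ge0//= -lee_fin probability_fineK//.
exact: probability_le1.
Qed.

Lemma dTV_fin_num P Q : dTV P Q \is a fin_num.
Proof.
have h1 : (dTV P Q <= 1%:E)%E.
  apply: dTV_le => A mA; have /andP[? ?] := fine_probability01 P mA.
  by have /andP[? ?] := fine_probability01 Q mA; rewrite ler_norml; lra.
have h0 := dTV_ge P Q (@measurable0 _ T).
rewrite fin_real// (lt_le_trans _ h0) ?ltNyr//=.
by rewrite (le_lt_trans h1)// ltry.
Qed.

Lemma fine_probabilityDI P (A B : set T) : measurable A -> measurable B ->
  fine (P A) = fine (P (A `\` B)) + fine (P (A `&` B)).
Proof.
move=> mA mB; rewrite -fineD ?fin_num_measure//.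
- by rewrite -measureDI.
- exact: measurableD.
- exact: measurableI.
Qed.

(** The positive set of a Hahn decomposition of the charge P - Q takes the place of the set where
    one density exceeds the other. *)
Lemma scheffe_set P Q : exists2 S : set T, measurable S &
  forall A, measurable A ->
    `|fine (P A) - fine (Q A)| <= `|fine (P S) - fine (Q S)|.
Proof.
pose nu := cadd (charge_of_finite_measure P) (copp (charge_of_finite_measure Q)).
have nuE A : measurable A -> nu A = (fine (P A) - fine (Q A))%:E.
  by move=> mA; rewrite EFinB !probability_fineK.
have [S [N [[mS posS] [mN negN] SN SN0]]] := Hahn_decomposition nu.
exists S => // A mA.
have NE : N = ~` S.
  apply/seteqP; split => x.
    by move=> Nx Sx; have : (S `&` N) x by []; rewrite SN0.
  by move=> nSx; have : [set: T] x by []; rewrite -SN => -[].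
pose f B := fine (P B) - fine (Q B).
have fDI B C : measurable B -> measurable C -> f B = f (B `\` C) + f (B `&` C).
  move=> mB mC; rewrite /f (fine_probabilityDI P mB mC) (fine_probabilityDI Q mB mC).
  by lra.
have fpos B : measurable B -> B `<=` S -> 0 <= f B.
  by move=> mB BS; rewrite -lee_fin -nuE//; exact: posS.
have fneg B : measurable B -> B `<=` ~` S -> f B <= 0.
  by move=> mB BS; rewrite -lee_fin -nuE//; apply: negN => //; rewrite NE.
have mI := measurableI _ _ mA mS.
have mD1 := measurableD mA mS.
have mD2 := measurableD mS mA.
have mC := measurableC (measurableU _ _ mA mS).
have e1 := fDI A S mA mS.
have e2 := fDI S A mS mA; rewrite setIC in e2.
(* Zero total mass turns the upper bound into a lower one: f A = - f (S \ A) - f (~ (A U S)) >= - f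
   S. *)
have e3 : f setT = f A + f (S `\` A) + f (~` (A `|` S)).
  rewrite (fDI setT (A `|` S) measurableT (measurableU _ _ mA mS)).
  rewrite setTI setTD addrC; congr (_ + _).
  rewrite (fDI (A `|` S) A (measurableU _ _ mA mS) mA) addrC setUK.
  by congr (_ + f _); rewrite setDUl setDv set0U.
have eT : f setT = 0 by rewrite /f !probability_setT subrr.
have h1 := fpos _ mI (@subIsetr _ _ _).
have h2 : 0 <= f (S `\` A) by apply: fpos => // x [].
have h3 : f (A `\` S) <= 0 by apply: fneg => // x [].
have h4 : f (~` (A `|` S)) <= 0 by apply: fneg => // x nAS Sx; apply: nAS; right.
rewrite -/(f A) -/(f S) (ger0_norm (_ : 0 <= f S)); last by lra.
by rewrite ler_norml; lra.
Qed.

End total_variation.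

Section score.
Context (R : realType) (n : nat) (I : finType).
Implicit Types (h : 'I_n -> I -> R) (q : I -> R).

(* The index p ranges over Scheffe sets: h i p is the mass hypothesis i gives
   to the p-th set, q p the true or estimated mass of that set. *)
Definition score h q (i : 'I_n) : R := \big[Num.max/0]_(p : I) `|h i p - q p|.

Lemma le_score h q i p : `|h i p - q p| <= score h q i.
Proof. by rewrite /score (bigD1 p)//= le_max lexx. Qed.

Lemma score_le h q i e : 0 <= e -> (forall p, `|h i p - q p| <= e) ->
  score h q i <= e.
Proof.
move=> e0 hp; rewrite /score; elim/big_ind: _ => // x y xe ye.
by rewrite ge_max xe.
Qed.

Lemma score_ge0 h q i : 0 <= score h q i.
Proof.
rewrite /score; elim/big_ind: _ => // x y x0 y0.
by rewrite le_max x0.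
Qed.

Lemma score_lipschitz h q q' e i : 0 <= e -> (forall p, `|q p - q' p| <= e) ->
  score h q i <= score h q' i + e.
Proof.
move=> e0 qq; apply: score_le => [|p]; first by rewrite addr_ge0// score_ge0.
rewrite -(subrKA (q' p)) (le_trans (ler_normD _ _))//.
by rewrite lerD ?le_score// distrC.
Qed.

Lemma measurable_score d (X : measurableType d) h (q : X -> I -> R) i :
  (forall p, measurable_fun setT (fun x => q x p)) ->
  measurable_fun setT (fun x => score h (q x) i).
Proof.
move=> mq; rewrite /score.
elim: (index_enum I) => [|p s IH].
  by under eq_fun do rewrite big_nil; exact: measurable_cst.
under eq_fun do rewrite big_cons.
apply: measurable_maxr => //; apply: measurableT_comp => //.
exact: measurable_funB.
Qed.

End score.

Section minimum_distance.
Context (R : realType) d (T : measurableType d) (n : nat).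
Variables (H : 'I_n -> probability T R) (S : 'I_n * 'I_n -> set T).
Hypothesis mS : forall p, measurable (S p).
Hypothesis scheffeS : forall p A, measurable A ->
  `|fine (H p.1 A) - fine (H p.2 A)| <= `|fine (H p.1 (S p)) - fine (H p.2 (S p))|.

Definition hypotheses_on (i : 'I_n) p : R := fine (H i (S p)).

Variable P : probability T R.

(** Let [j] be at distance D from [P]. The Scheffe set of [(i, j)] bounds the distance between [H i]
    and [H j] by the sum of their scores, hence by 2 D + e; the triangle inequality through [H j]
    adds the third D. *)
Lemma minimum_distance_select (i : 'I_n) (e : R) :
  (forall j, score hypotheses_on (fun p => fine (P (S p))) i <=
             score hypotheses_on (fun p => fine (P (S p))) j + e) ->
  (dTV (H i) P <= 3%:E * (\big[mine/+oo]_(j < n) dTV (H j) P) + e%:E)%E.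
Proof.
move=> hi.
(* The minimum is either attained or equal to its default [+oo], for which the bound is trivial. *)
have : (\big[mine/+oo]_(j < n) dTV (H j) P = +oo \/
        exists j, \big[mine/+oo]_(j < n) dTV (H j) P = dTV (H j) P)%E.
  elim/big_ind: _ => [|x y hx hy|j _]; [by left| |by right; exists j].
  by rewrite /mine; case: ifP.
move=> [->|[j ->]].
  by rewrite gt0_muley ?lte_fin// addye// leey.
rewrite -(fineK (dTV_fin_num (H j) P)) -EFinM -EFinD.
set D := fine (dTV (H j) P).
have hD A : measurable A -> `|fine (H j A) - fine (P A)| <= D.
  by move=> mA; rewrite -lee_fin /D fineK ?dTV_fin_num//; exact: dTV_ge.
have D0 : 0 <= D by apply: le_trans (hD _ measurableT).
apply: dTV_le => A mA.
have sj : score hypotheses_on (fun p => fine (P (S p))) j <= D.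
  by apply: score_le => // p; exact: hD.
have h1 := hD _ mA.
have h2 := @scheffeS (i, j) _ mA; rewrite /= in h2.
have h3 := le_score hypotheses_on (fun p => fine (P (S p))) i (i, j).
have h4 := le_score hypotheses_on (fun p => fine (P (S p))) j (i, j).
rewrite /hypotheses_on in h3 h4.
have h5 : `|fine (H i (S (i, j))) - fine (H j (S (i, j)))| <=
   `|fine (H i (S (i, j))) - fine (P (S (i, j)))| +
   `|fine (H j (S (i, j))) - fine (P (S (i, j)))|.
  rewrite -(subrKA (fine (P (S (i, j))))) (le_trans (ler_normD _ _))//.
  by rewrite lerD2l distrC.
have h6 : `|fine (H i A) - fine (P A)| <=
   `|fine (H i A) - fine (H j A)| + `|fine (H j A) - fine (P A)|.
  by rewrite -(subrKA (fine (H j A))) ler_normD.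
have h7 := hi j.
rewrite /hypotheses_on in sj h7.
lra.
Qed.

End minimum_distance.

Lemma scheffe_family (R : realType) d (T : measurableType d) n
    (H : 'I_n -> probability T R) : exists2 S : 'I_n * 'I_n -> set T,
  (forall p, measurable (S p)) & forall p A, measurable A ->
  `|fine (H p.1 A) - fine (H p.2 A)| <= `|fine (H p.1 (S p)) - fine (H p.2 (S p))|.
Proof.
have h p := cid2 (scheffe_set (H p.1) (H p.2)).
by exists (fun p => s2val (h p)) => p; [exact: (s2valP (h p))|exact: (s2valP' (h p))].
Qed.

(** * The staged algorithm *)

Section product_events.
Context (R : realType) d (X : measurableType d) (Q : probability X R).
Local Open Scope classical_set_scope.
Local Open Scope ereal_scope.

Lemma product_fst d' (Y : measurableType d') (Q' : probability Y R) (A : set X) :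
  measurable A -> (Q \x Q') [set z | A z.1] = Q A.
Proof.
move=> mA; rewrite (_ : [set z | A z.1] = A `*` setT).
  by rewrite product_measure1E// -[RHS]mule1 -[in RHS](probability_setT Q').
by apply/seteqP; split => z /= => [|[]].
Qed.

Lemma product_snd d' (Y : measurableType d') (Q' : probability Y R) (A : set Y) :
  measurable A -> (Q \x Q') [set z | A z.2] = Q' A.
Proof.
move=> mA; rewrite (_ : [set z | A z.2] = setT `*` A).
  by rewrite product_measure1E// -[RHS]mul1e -[in RHS](probability_setT Q).
by apply/seteqP; split => z /= => [|[]].
Qed.

Lemma probability_gt_le (g : X -> R) (t e : R) : (0 < t)%R ->
  measurable_fun setT g -> (forall x, 0 <= g x)%R ->
  \int[Q]_x (g x)%:E <= e%:E -> Q [set x | (t < g x)%R] <= (e / t)%:E.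
Proof.
move=> t0 mg g0 ge.
have mA : measurable [set x | (t < g x)%R] by exact: measurable_lt_set.
rewrite EFinM lee_pdivlMr// muleC.
apply: le_trans ge.
apply: (@le_trans _ _ (\int[Q]_x (t%:E * (\1_[set x | (t < g x)%R] x)%:E))).
  rewrite ge0_integralZl_EFin ?(ltW t0)//; last exact/measurable_EFinP.
  by rewrite integral_indic// setIT.
apply: ge0_le_integral => //.
- by move=> x _; rewrite mule_ge0// lee_fin// ltW.
- by apply: measurable_funeM; exact/measurable_EFinP.
- exact/measurable_EFinP.
move=> x _; rewrite indicE; case: (boolP (x \in _)) => [|_].
  by rewrite inE /= mule1 lee_fin => /ltW.
by rewrite mule0 lee_fin.
Qed.

Lemma measurable_near_tie n (v : 'I_n -> R) (t : X -> R) : measurable_fun setT t ->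
  measurable [set z : X * stream (measurableTypeR R) | near_tie v (t z.1) z.2].
Proof.
move=> mt; apply: measurable_exists => i; apply: measurable_exists => j.
have mr (l : 'I_n) : measurable_fun setT
    (fun z : X * stream (measurableTypeR R) => (v l - z.2 l)%R : R).
  apply: measurable_funB => //.
  exact: (measurableT_comp (measurable_coord l) measurable_snd).
rewrite (_ : [set z | _] =
  [set z : X * stream (measurableTypeR R) | i != j /\
    ((forall l : 'I_n, (v i - z.2 i <= v l - z.2 l)%R) /\
     (v j - z.2 j <= v i - z.2 i + t z.1)%R)]); last first.
  by apply/seteqP; split => z /= => [[? ? ?]|[? [? ?]]].
apply: measurable_and2; first exact: measurable_constprop.
apply: measurable_and2.
  by apply: measurable_forall => l; exact: measurable_le_set.
apply: measurable_le_set => //; apply: measurable_funD => //.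
exact: (measurableT_comp mt measurable_fst).
Qed.

(** The tolerance depends on the samples, which are independent of the noise. Since [iid_near_tie]
    is linear in the tolerance, integrating it leaves only the mean tolerance; this is why
    expectations of excesses suffice. *)
Lemma product_near_tie n (v : 'I_n -> R) (t : X -> R) : measurable_fun setT t ->
  (forall x, 0 <= t x)%R ->
  (Q \x iid (exp_law R)) [set z | near_tie v (t z.1) z.2] <= \int[Q]_x (t x)%:E.
Proof.
move=> mt t0; have mN := measurable_near_tie v mt.
apply: ge0_le_integral => //.
- exact: measurable_fun_xsection.
- exact/measurable_EFinP.
move=> x _ /=; apply: le_trans (iid_near_tie v (t0 x)).
by rewrite le_eqVlt; apply/orP; left; apply/eqP; congr (iid _ _);
  apply/seteqP; split => r; rewrite /xsection/= inE.
Qed.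

End product_events.

Section argmin.
Context (R : realType) (n : nat) (i0 : 'I_n).

(** The minimizer is read off the Boolean table of comparisons, so that its measurability reduces to
    that of each comparison. *)
Definition least_index (b : {ffun 'I_n * 'I_n -> bool}) : 'I_n :=
  odflt i0 [pick i | [forall j, b (i, j)]].

Definition argmin (f : 'I_n -> R) : 'I_n :=
  least_index [ffun p => f p.1 <= f p.2].

Lemma argminP f j : f (argmin f) <= f j.
Proof.
rewrite /argmin /least_index; case: pickP => [i /forallP/(_ j)|none] /=.
  by rewrite ffunE.
have [i _ imin] := @Order.TotalTheory.arg_minP _ _ _ i0 xpredT f erefl.
have := none i; move/negP; case; apply/forallP => l.
by rewrite ffunE imin.
Qed.

Lemma measurable_argmin d (X : measurableType d) (f : X -> 'I_n -> R) i :
  (forall j, measurable_fun setT (fun x => f x j)) ->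
  measurable [set x | argmin (f x) = i]%classic.
Proof.
move=> mf.
exact: (measurable_finfun_bool (b := fun x p => f x p.1 <= f x p.2)
  (fun phi => least_index phi = i) (fun p => measurable_le_set (mf p.1) (mf p.2))).
Qed.

End argmin.

Section staged_selection.
Context (R : realType) d (T : measurableType d) (n : nat) (i0 : 'I_n).
Variables (I : finType) (h : 'I_n -> I -> R) (S : I -> set T).
Hypothesis mS : forall p, measurable (S p).
Variables (eta : R) (K : nat) (m : nat -> nat) (theta : nat -> R).
Hypothesis eta0 : 0 < eta.
Hypothesis m_nd : {homo m : i j / (i <= j)%N}.
Hypothesis theta0 : forall k, 0 < theta k.
Local Open Scope classical_set_scope.

Local Notation seeds := (stream (measurableTypeR R)).

Definition cost k (z : stream T * seeds) (i : 'I_n) : R :=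
  score h (fun p => empirical R (m k) (S p) z.1) i - eta * z.2 i.

Definition wins k z := [exists i, [forall j, (j != i) ==>
  (cost k z i + theta k < cost k z j)]].

(** [find] returns [K] when no stage before [K] has a clear leader. Stage [K] is thus a forced stop,
    whose leader is output without a test. *)
Definition stage z := find (fun k => wins k z) (iota 0 K).

Definition staged_output x r := argmin i0 (cost (stage (x, r)) (x, r)).

Definition staged_nsamples x r := Some (m (stage (x, r))).

Lemma stage_le z : (stage z <= K)%N.
Proof. by rewrite -[leqRHS](size_iota 0 K) find_size. Qed.

Lemma stage_wins z : (stage z < K)%N -> wins (stage z) z.
Proof.
move=> sK; have hs : has (fun k => wins k z) (iota 0 K).
  by rewrite has_find size_iota.
by have := nth_find 0%N hs; rewrite nth_iota.
Qed.

Lemma stage_before z k : (k < stage z)%N -> wins k z = false.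
Proof.
move=> ks; have := before_find 0%N ks.
by rewrite nth_iota// (leq_trans ks)// stage_le.
Qed.

Lemma measurable_cost k i : measurable_fun setT (fun z => cost k z i).
Proof.
apply: measurable_funB.
  apply: measurable_score => p.
  exact: (measurableT_comp (measurable_empirical (m k) (mS p)) measurable_fst).
apply: measurable_funM => //.
exact: (measurableT_comp (measurable_coord i) measurable_snd).
Qed.

Lemma measurable_wins k : measurable [set z | wins k z].
Proof.
rewrite (_ : [set z | _] = [set z | exists i, forall j, j != i ->
    cost k z i + theta k < cost k z j]).
  apply: measurable_exists => i; apply: measurable_forall => j.
  apply: measurable_imply; apply: measurable_lt_set; last exact: measurable_cost.
  by apply: measurable_funD => //; exact: measurable_cost.
apply/seteqP; split => z /=.
  by move=> /existsP[i /forallP ij]; exists i => j; exact/implyP.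
by move=> [i ij]; apply/existsP; exists i; apply/forallP => j; apply/implyP/ij.
Qed.

Lemma measurable_stage k : measurable [set z | stage z = k].
Proof.
(* The search reads only the tests below [K]; expressed through their finite table it falls under
   [measurable_finfun_bool]. *)
rewrite (_ : [set z | _] = [set z |
    find (fun k' => oapp [ffun i : 'I_K => wins i z] false (insub k')) (iota 0 K) = k]).
  apply: (measurable_finfun_bool (b := fun z (i : 'I_K) => wins i z)
    (fun phi => find (fun k' => oapp phi false (insub k')) (iota 0 K) = k)).
  by move=> i; exact: measurable_wins.
apply/seteqP; split => z /= <-; [symmetry|]; apply: eq_in_find => l;
  rewrite mem_iota => /= lK; by rewrite insubT /= ffunE.
Qed.

Lemma measurable_staged_output i :
  measurable [set z : stream T * seeds | staged_output z.1 z.2 = i].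
Proof.
rewrite (_ : [set z | _] = [set z : stream T * seeds | exists k : 'I_K.+1, stage z = k /\
    argmin i0 (cost k z) = i]).
  apply: measurable_exists => k; apply: measurable_and2.
    exact: measurable_stage.
  by apply: measurable_argmin => j; exact: measurable_cost.
apply/seteqP; split => [[x r]|[x r]] /=.
  have sK : (stage (x, r) < K.+1)%N by exact: stage_le.
  by move=> <-; exists (Ordinal sK).
by rewrite /staged_output => -[k [-> <-]].
Qed.

Lemma measurable_staged_nsamples k :
  measurable [set z : stream T * seeds | staged_nsamples z.1 z.2 = Some k].
Proof.
rewrite (_ : [set z | _] = [set z : stream T * seeds |
    exists l : 'I_K.+1, m l = k /\ stage z = l]).
  apply: measurable_exists => l; apply: measurable_and2.
    exact: measurable_constprop.
  exact: measurable_stage.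
apply/seteqP; split => [[x r]|[x r]] /=.
  have sK : (stage (x, r) < K.+1)%N by exact: stage_le.
  by move=> [<-]; exists (Ordinal sK).
by move=> [l [<- e]]; rewrite /staged_nsamples e.
Qed.

Lemma cost_prefix k l x y r : (k <= l)%N ->
  (forall j, (j < m l)%N -> x j = y j) -> cost k (x, r) = cost k (y, r).
Proof.
move=> kl xy; apply/funext => i; rewrite /cost/=; congr (_ - _).
congr (score h _ i); apply/funext => p; apply: empirical_prefix => j jk.
by apply: xy; rewrite (leq_trans jk)// m_nd.
Qed.

(** Every test up to the stopping stage reads a prefix of the first [m (stage (x, r))] samples, so
    the tests answer alike on [y] and the search ends at the same place. *)
Lemma stage_prefix x y r :
  (forall j, (j < m (stage (x, r)))%N -> x j = y j) ->
  stage (y, r) = stage (x, r).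
Proof.
move=> xy.
have wE k : (k <= stage (x, r))%N -> wins k (y, r) = wins k (x, r).
  by move=> kl; rewrite /wins (cost_prefix r kl xy).
have [lt|gt|//] := ltngtP (stage (y, r)) (stage (x, r)).
  have sK := leq_trans lt (stage_le _).
  by have := stage_wins sK; rewrite wE ?(ltnW lt)// stage_before.
have sK := leq_trans gt (stage_le _).
by have := stage_wins sK; rewrite -wE// stage_before.
Qed.

Lemma staged_prefix x y r k : staged_nsamples x r = Some k ->
  (forall j, (j < k)%N -> x j = y j) ->
  staged_nsamples y r = Some k /\ staged_output y r = staged_output x r.
Proof.
move=> [<-] xy; have e := stage_prefix xy; split; first by rewrite /staged_nsamples e.
by rewrite /staged_output e -(cost_prefix r (leqnn _) xy).
Qed.

Definition staged_algorithm : algorithm R T n :=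
  @Algorithm R d T n _ seeds (iid (exp_law R)) staged_output staged_nsamples
    measurable_staged_output measurable_staged_nsamples staged_prefix.

Section analysis.
Variable P : probability T R.

Let truth p := fine (P (S p)).

(** Division by [eta] brings the noise to the unit scale of [iid_near_tie]. *)
Definition scaled_score i := score h truth i / eta.

(** A sum rather than a maximum: it dominates every excess, and its expectation splits over the
    sets. *)
Definition total_excess k (x : stream T) : R :=
  \sum_(p : I) excess P (m k) (theta k) (S p) x.

Lemma measurable_total_excess k : measurable_fun setT (total_excess k).
Proof. by apply: measurable_sum => p; exact: measurable_excess. Qed.

Lemma total_excess_ge0 k x : 0 <= total_excess k x.
Proof. by apply: sumr_ge0 => p _; exact: excess_ge0. Qed.

Lemma deviation_le k x p :
  `|empirical R (m k) (S p) x - truth p| <= (theta k + total_excess k x) / 2.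
Proof.
have h1 : excess P (m k) (theta k) (S p) x <= total_excess k x.
  rewrite /total_excess (bigD1 p)//= lerDl.
  by apply: sumr_ge0 => q _; exact: excess_ge0.
have : 2 * `|deviation P (m k) (S p) x| - theta k <= excess P (m k) (theta k) (S p) x.
  by rewrite /excess le_max lexx orbT.
rewrite /deviation -/(truth p); lra.
Qed.

Lemma cost_error k x r i : let e := (theta k + total_excess k x) / 2 in
  cost k (x, r) i <= eta * (scaled_score i - r i) + e /\
  eta * (scaled_score i - r i) <= cost k (x, r) i + e.
Proof.
move=> e; have e0 : 0 <= e.
  by rewrite divr_ge0// addr_ge0// ?total_excess_ge0// ltW.
have sE : eta * (scaled_score i - r i) = score h truth i - eta * r i.
  by rewrite mulrBr /scaled_score mulrC divfK// gt_eqF.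
have h1 : score h (fun p => empirical R (m k) (S p) x) i <= score h truth i + e.
  by apply: score_lipschitz => // p; exact: deviation_le.
have h2 : score h truth i <= score h (fun p => empirical R (m k) (S p) x) i + e.
  by apply: score_lipschitz => // p; rewrite distrC; exact: deviation_le.
by rewrite sE /cost/=; split; lra.
Qed.

Definition ideal_output (r : seeds) := argmin i0 (fun i => scaled_score i - r i).

(** The margin of a clear leader cancels the term [theta k] of the error and leaves the excess. At
    the forced stop [k == K] there is no margin, so [theta K] remains. *)
Definition slack k x := ((if k == K then theta k else 0) + total_excess k x) / eta.

Lemma measurable_slack k : measurable_fun setT (slack k).
Proof.
apply: measurable_funM => //; apply: measurable_funD => //.
exact: measurable_total_excess.
Qed.

Lemma slack_ge0 k x : 0 <= slack k x.
Proof.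
rewrite divr_ge0 ?(ltW eta0)// addr_ge0 ?total_excess_ge0//.
by case: ifP => // _; exact: ltW.
Qed.

(* The ideal output depends on the seed but not on the samples, so this turns
   non-replicability into a near-tie event about the seed alone. *)
Lemma wrong_output_near_tie x r : staged_output x r != ideal_output r ->
  exists k : 'I_K.+1, near_tie scaled_score (slack k x) r.
Proof.
move=> neq; set k := stage (x, r).
have sK : (k < K.+1)%N by exact: stage_le.
exists (Ordinal sK); exists (ideal_output r), (staged_output x r); split.
- by rewrite eq_sym.
- by move=> l; exact: argminP i0 (fun i => scaled_score i - r i) l.
set a := ideal_output r; set b := staged_output x r.
have [_ hb] := cost_error k x r b; have [ha _] := cost_error k x r a.
have hba : cost k (x, r) b <= cost k (x, r) a by exact: argminP.
rewrite -(ler_pM2l eta0) [leRHS]mulrDr /slack /=.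
set tk := if k == K then theta k else 0.
have -> : eta * ((tk + total_excess k x) / eta) = tk + total_excess k x.
  by rewrite mulrC divfK// gt_eqF.
rewrite /tk; case: eqVneq => [kK|kK]; first by lra.
have kK' : (k < K)%N by rewrite ltn_neqAle kK -ltnS.
have /existsP[i /forallP wi] := stage_wins kK'.
(* An early stop outputs the winner of the test just passed, so the margin of that test applies to
   [b]. *)
have bi : b = i.
  apply/eqP; apply: contraT => bi.
  have := wi b; rewrite bi/= -/k => hib.
  have : cost k (x, r) b <= cost k (x, r) i by exact: argminP.
  by have := theta0 k; lra.
by have := wi a; rewrite -bi eq_sym neq/= -/k; lra.
Qed.

(** If the ideal output does not win at stage [k], some rival is within [theta k] of it in cost;
    passing to the true masses adds [theta k] plus the excess, whence [2 * theta k]. *)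
Lemma unresolved_near_tie k x r : ~~ wins k (x, r) ->
  near_tie scaled_score ((2 * theta k + total_excess k x) / eta) r.
Proof.
move=> /existsPn /(_ (ideal_output r)) /forallPn[j]; rewrite negb_imply => /andP[ji].
rewrite -leNgt => hj; exists (ideal_output r), j; split.
- by rewrite eq_sym.
- by move=> l; exact: argminP i0 (fun i => scaled_score i - r i) l.
have [_ h1] := cost_error k x r j; have [h2 _] := cost_error k x r (ideal_output r).
rewrite -(ler_pM2l eta0) [leRHS]mulrDr.
have -> : eta * ((2 * theta k + total_excess k x) / eta) = 2 * theta k + total_excess k x.
  by rewrite mulrC divfK// gt_eqF.
lra.
Qed.

Lemma output_score k x r U j : stage (x, r) = k -> total_excess k x <= theta k ->
  (forall i : 'I_n, 0 <= r i <= U) ->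
  score h truth (staged_output x r) <= score h truth j + (2 * theta k + eta * U).
Proof.
move=> sk gk rU; set b := staged_output x r.
have hb : cost k (x, r) b <= cost k (x, r) j by rewrite -sk; exact: argminP.
have e0 : 0 <= theta k by exact: ltW.
have hd p : `|empirical R (m k) (S p) x - truth p| <= theta k.
  by apply: (le_trans (deviation_le _ _ _)); lra.
have h1 : score h (fun p => empirical R (m k) (S p) x) j <= score h truth j + theta k.
  by apply: score_lipschitz.
have h2 : score h truth b <= score h (fun p => empirical R (m k) (S p) x) b + theta k.
  by apply: score_lipschitz => // p; rewrite distrC.
move: hb; rewrite /cost/=.
have /andP[? rb] := rU b; have /andP[rj ?] := rU j.
have := ler_wpM2l (ltW eta0) rb; have := mulr_ge0 (ltW eta0) rj.
lra.
Qed.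

(** The final size is charged to the failed test just before it: stopping at stage s > 0 means that
    stage s - 1 had no clear leader, and the summand [k = s - 1] alone covers [m s]. *)
Lemma staged_nsamples_le z : ((m (stage z))%:R <=
  (m 0)%:R + \sum_(k < K) (m k.+1)%:R * \1_[set z | ~~ wins k z] z :> R).
Proof.
have [->|s0] := eqVneq (stage z) 0%N.
  by rewrite lerDl sumr_ge0// => k _; rewrite mulr_ge0.
have sK := stage_le z.
have pK : ((stage z).-1 < K)%N by rewrite prednK ?lt0n.
rewrite (bigD1 (Ordinal pK))//= prednK ?lt0n// indicE mem_set/=; last first.
  by rewrite stage_before// prednK ?lt0n.
by rewrite mulr1 addrCA lerDl addr_ge0// sumr_ge0.
Qed.

End analysis.

End staged_selection.

Section product_integrals.
Context (R : realType) d d' (X : measurableType d) (Y : measurableType d').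
Variables (Q : probability X R) (Q' : probability Y R).
Local Open Scope classical_set_scope.
Local Open Scope ereal_scope.

Lemma integral_product_fst (f : X -> \bar R) : measurable_fun setT f ->
  (forall x, 0 <= f x) -> \int[Q \x Q']_z f z.1 = \int[Q]_x f x.
Proof.
move=> mf f0; rewrite fubini_tonelli1//; last first.
  exact: (measurableT_comp mf measurable_fst).
apply: eq_integral => x _; rewrite /fubini_F/= integral_cst//.
by rewrite -[RHS]mule1 -[in RHS](probability_setT Q').
Qed.

Lemma integral_product_snd (f : Y -> \bar R) : measurable_fun setT f ->
  (forall y, 0 <= f y) -> \int[Q \x Q']_z f z.2 = \int[Q']_y f y.
Proof.
move=> mf f0; rewrite fubini_tonelli2//; last first.
  exact: (measurableT_comp mf measurable_snd).
apply: eq_integral => y _; rewrite /fubini_G/= integral_cst//.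
by rewrite -[RHS]mule1 -[in RHS](probability_setT Q).
Qed.

Lemma product_probability_setC (A : set (X * Y)) : measurable A ->
  (Q \x Q') (~` A) = 1 - (Q \x Q') A.
Proof. by move=> mA; rewrite -(probability_setC (Q \x Q')%E). Qed.

Lemma product_probability_ge (A B : set (X * Y)) (e : R) :
  measurable A -> measurable B -> ~` B `<=` A -> (Q \x Q') B <= e%:E ->
  (1 - e)%:E <= (Q \x Q') A.
Proof.
move=> mA mB BA Be.
apply: (@le_trans _ _ ((Q \x Q') (~` B))).
  by rewrite product_probability_setC// EFinB leeB.
by rewrite le_measure ?inE//; exact: measurableC.
Qed.

End product_integrals.

(** * Replicability, accuracy and sample counts of the staged algorithm *)

Section staged_guarantees.
Context (R : realType) d (T : measurableType d) (n : nat) (i0 : 'I_n).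
Variables (H : 'I_n -> probability T R) (S : 'I_n * 'I_n -> set T).
Hypothesis mS : forall p, measurable (S p).
Hypothesis scheffeS : forall p A, measurable A ->
  `|fine (H p.1 A) - fine (H p.2 A)| <= `|fine (H p.1 (S p)) - fine (H p.2 (S p))|.
Variables (eta : R) (K : nat) (m : nat -> nat) (theta delta : nat -> R).
Hypothesis eta0 : 0 < eta.
Hypothesis m_nd : {homo m : i j / (i <= j)%N}.
Hypothesis theta0 : forall k, 0 < theta k.
Hypothesis delta_excess : forall (P : probability T R) k, (k <= K)%N ->
  (\int[iid P]_x (total_excess S m theta P k x)%:E <= (delta k)%:E)%E.
Local Open Scope classical_set_scope.

Let h := hypotheses_on H S.
Let A := staged_algorithm i0 h mS eta K theta m_nd.

Lemma integral_affine_excess (P : probability T R) k (a : R) : (k <= K)%N -> 0 <= a ->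
  (\int[iid P]_x ((a + total_excess S m theta P k x) / eta)%:E <=
   ((a + delta k) / eta)%:E)%E.
Proof.
move=> kK a0.
have mg := measurable_total_excess mS m theta P k.
have g0 := total_excess_ge0 S m theta P k.
have ie0 : 0 <= eta^-1 by rewrite invr_ge0 ltW.
under eq_integral do rewrite mulrC EFinM EFinD.
rewrite ge0_integralZl_EFin//=; last 2 first.
- by move=> x _; rewrite adde_ge0// lee_fin.
- by apply: emeasurable_funD => //; exact/measurable_EFinP.
rewrite mulrC EFinM lee_wpmul2l ?lee_fin//.
rewrite ge0_integralD//=; [|by move=> x _; rewrite lee_fin|exact/measurable_EFinP].
rewrite EFinD leeD ?delta_excess// integral_cst//.
by rewrite -[leRHS]mule1 lee_wpmul2l ?lee_fin// probability_le1.
Qed.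

Lemma integral_slack (P : probability T R) k : (k <= K)%N ->
  (\int[iid P]_x (slack S eta K m theta P k x)%:E <=
   (((if k == K then theta k else 0) + delta k) / eta)%:E)%E.
Proof.
move=> kK; apply: integral_affine_excess => //.
by case: ifP => // _; exact: ltW.
Qed.

(** A union bound over two runs, whence the factor 2, and over all stages. The margin enters only
    through [theta K], since only the forced stop keeps it in its slack. *)
Lemma staged_replicable (rho : R) :
  2 * (theta K + \sum_(k < K.+1) delta k) <= eta * rho -> replicable rho A.
Proof.
move=> hrho P.
pose B (bk : bool * 'I_K.+1) :=
  [set z : (stream T * stream T) * stream (measurableTypeR R) |
    near_tie (scaled_score h S eta P)
      (slack S eta K m theta P bk.2 (if bk.1 then z.1.1 else z.1.2)) z.2].
pose B' (bk : bool * 'I_K.+1) (y : stream T * stream T) :=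
  slack S eta K m theta P bk.2 (if bk.1 then y.1 else y.2).
have mB' (bk : bool * 'I_K.+1) : measurable_fun setT (B' bk).
  have ms := measurable_slack mS eta K m theta P bk.2.
  by rewrite /B'; case: bk.1;
    [exact: (measurableT_comp ms measurable_fst)|exact: (measurableT_comp ms measurable_snd)].
have B'0 bk y : 0 <= B' bk y by exact: slack_ge0.
have mB bk : measurable (B bk) by exact: (measurable_near_tie (scaled_score h S eta P) (mB' bk)).
have mU : measurable [set z | exists bk, B bk z] by exact: measurable_exists.
have mO (b : bool) i : measurable [set z : (stream T * stream T) * stream (measurableTypeR R) |
    staged_output i0 h S eta K m theta (if b then z.1.1 else z.1.2) z.2 = i].
  have mo := measurable_staged_output i0 h mS eta K m theta i.
  pose f (z : (stream T * stream T) * stream (measurableTypeR R)) :=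
    (if b then z.1.1 else z.1.2, z.2).
  have mf : measurable_fun setT f.
    apply/measurable_fun_pairP; split; last exact: measurable_snd.
    case: b @f; [exact: (measurableT_comp measurable_fst measurable_fst)|
      exact: (measurableT_comp measurable_snd measurable_fst)].
  by have := mf measurableT _ mo; rewrite setTI.
apply: (product_probability_ge _ mU).
- rewrite (_ : [set z | _] = [set z : (stream T * stream T) * stream (measurableTypeR R) |
      exists i, staged_output i0 h S eta K m theta z.1.1 z.2 = i /\
                staged_output i0 h S eta K m theta z.1.2 z.2 = i]).
    apply: measurable_exists => i; apply: measurable_and2; [exact: (mO true)|exact: (mO false)].
  apply/seteqP; split => [z e|z [i [e1 e2]]]; last exact (etrans e1 (esym e2)).
  by exists (staged_output i0 h S eta K m theta z.1.1 z.2); split; [reflexivity|exact (esym e)].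
- move=> [[x y] r]; rewrite /setC/= => nB.
  suff wr u b : u = (if b then x else y) ->
      staged_output i0 h S eta K m theta u r = ideal_output i0 h S eta P r.
    by rewrite (wr x true)// (wr y false).
  move=> ->; apply/eqP; apply: contraT => /(wrong_output_near_tie eta0 theta0)[k hk].
  by case: nB; exists (b, k).
have key bk : (((iid P \x iid P) \x iid (exp_law R)) (B bk) <=
    (((if bk.2 == K :> nat then theta bk.2 else 0) + delta bk.2) / eta)%:E)%E.
  apply: (le_trans (product_near_tie _ _ (mB' bk) (B'0 bk))).
  have ms := measurable_slack mS eta K m theta P bk.2.
  have s0 x : (0 <= (slack S eta K m theta P bk.2 x)%:E)%E.
    by rewrite lee_fin; exact: slack_ge0.
  have kK : (bk.2 <= K)%N by rewrite -ltnS.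
  apply: (le_trans _ (integral_slack P kK)); rewrite le_eqVlt; apply/orP; left; apply/eqP.
  rewrite /B'; case: bk.1 => /=.
    apply: (integral_product_fst (iid P) (iid P) (f := fun x => (slack S eta K m theta P bk.2 x)%:E)) => //.
    exact/measurable_EFinP.
  apply: (integral_product_snd (iid P) (iid P) (f := fun x => (slack S eta K m theta P bk.2 x)%:E)) => //.
  exact/measurable_EFinP.
apply: (@le_trans _ _ (\sum_(bk : bool * 'I_K.+1)
    (((if bk.2 == K :> nat then theta bk.2 else 0) + delta bk.2) / eta)%:E)%E).
  apply: (le_trans (measure_union_bound ((iid P \x iid P) \x iid (exp_law R))%E mU mB _)) => //.
  by apply: lee_sum => bk _; exact: key.
rewrite sumEFin lee_fin -mulr_suml ler_pdivrMr// [leRHS]mulrC.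
apply: le_trans hrho.
rewrite (eq_bigr (fun bk => (fun (_ : bool) (k : 'I_K.+1) =>
  (if k == K :> nat then theta k else 0) + delta k) bk.1 bk.2)); last by case.
rewrite -(pair_bigA _ (fun (_ : bool) (k : 'I_K.+1) =>
  (if k == K :> nat then theta k else 0) + delta k))/=.
rewrite sumr_const card_bool mulr_natl lerMn2r/= big_split lerD2r/=.
rewrite big_ord_recr/= eqxx big1 ?add0r// => k _.
by rewrite ltn_eqF.
Qed.

(** The stopping stage is random, so the excess is controlled at all stages at once; Markov's
    inequality gives [delta k / theta k] for each. The other term pays for noise outside [0, U]. *)
Lemma staged_selects (eps U fail : R) : 0 < U ->
  (forall k, (k <= K)%N -> 2 * theta k + eta * U <= eps) ->
  n%:R * expR (- U) + \sum_(k < K.+1) delta k / theta k <= fail ->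
  selects H 3 eps fail A.
Proof.
move=> U0 heps hfail P.
pose B (o : option 'I_K.+1) := if o is Some k
  then [set z : stream T * stream (measurableTypeR R) |
         theta k < total_excess S m theta P k z.1]
  else [set z : stream T * stream (measurableTypeR R) |
         exists i : 'I_n, ~~ (0 <= z.2 i <= U)].
have mg k := measurable_total_excess mS m theta P k.
have mr : measurable [set r : stream (measurableTypeR R) | exists i : 'I_n, ~~ (0 <= r i <= U)].
  apply: measurable_exists => i.
  rewrite (_ : [set r | _] = ~` ((fun r : stream (measurableTypeR R) => r i) @^-1` `[0, U])).
    apply: measurableC; rewrite -[X in measurable X]setTI.
    by apply: measurable_coord => //; exact: measurable_itv.
  by apply/seteqP; split => r /=; rewrite in_itv/= => /negP.
have mgt k : measurable [set x : stream T | theta k < total_excess S m theta P k x].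
  by apply: measurable_lt_set => //; exact: mg.
have mB o : measurable (B o).
  case: o => [k|]; rewrite /B.
    by have := @measurable_fst _ _ (stream T) (stream (measurableTypeR R)) measurableT _ (mgt k); rewrite setTI.
  by have := @measurable_snd _ _ (stream T) (stream (measurableTypeR R)) measurableT _ mr; rewrite setTI.
have mU : measurable [set z | exists o, B o z] by exact: measurable_exists.
apply: (product_probability_ge _ mU).
- rewrite (_ : [set z | _] = [set z : stream T * stream (measurableTypeR R) | exists i,
      staged_output i0 h S eta K m theta z.1 z.2 = i /\
      (dTV (H i) P <= 3%:E * (\big[mine/+oo]_(j < n) dTV (H j) P) + eps%:E)%E]).
    apply: measurable_exists => i; apply: measurable_and2; last exact: measurable_constprop.
    exact: measurable_staged_output.
  apply/seteqP; split => [z e|z [i [e]]]; last by rewrite -e.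
  by exists (staged_output i0 h S eta K m theta z.1 z.2); split; [reflexivity|exact e].
- move=> [x r]; rewrite /setC/= => nB.
  have sK : (stage h S eta K m theta (x, r) <= K)%N by exact: stage_le.
  have hr i : 0 <= (r : nat -> R) (i : 'I_n) <= U.
    by apply: contraT => ri; case: nB; exists None; exists i.
  have hg : total_excess S m theta P (stage h S eta K m theta (x, r)) x <=
      theta (stage h S eta K m theta (x, r)).
    rewrite leNgt; apply/negP => hlt; case: nB.
    by exists (Some (inord (stage h S eta K m theta (x, r)))); rewrite /B/= inordK.
  apply: (minimum_distance_select mS scheffeS) => j.
  apply: (le_trans (output_score i0 eta0 theta0 j erefl hg hr)).
  by rewrite lerD2l; exact: heps.
apply: (le_trans (measure_union_bound (iid P \x iid (exp_law R))%E mU mB _)) => //.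
rewrite (bigD1 None)//=.
apply: (@le_trans _ _ ((n%:R * expR (- U))%:E + \sum_(k < K.+1) (delta k / theta k)%:E)%E); last first.
  by rewrite sumEFin -EFinD lee_fin.
apply: leeD.
  apply: le_trans (iid_exp_range n U0).
  by rewrite le_eqVlt; apply/orP; left; apply/eqP; exact: (product_snd (iid P) (iid (exp_law R)) mr).
rewrite (reindex_omap Some id)/=; last by case.
rewrite (eq_bigl xpredT); last by move=> k; rewrite eqxx.
apply: lee_sum => k _.
rewrite [leLHS](product_fst (iid P) (iid (exp_law R)) (mgt k)).
apply: probability_gt_le => //.
- by apply: total_excess_ge0.
- by apply: delta_excess; rewrite -ltnS.
Qed.

Lemma staged_expected_samples : expected_samples A
  ((m 0)%:R + \sum_(k < K) (m k.+1)%:R * ((2 * theta k + delta k) / eta))%:E.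
Proof.
move=> P.
pose Z := (stream T * stream (measurableTypeR R))%type.
pose W k := [set z : Z | ~~ wins h S eta m theta k z].
have mW k : measurable (W k).
  rewrite (_ : W k = ~` [set z : Z | wins h S eta m theta k z]).
    by apply: measurableC; exact: measurable_wins.
  by apply/seteqP; split => z /= /negP.
pose st := stage h S eta K m theta.
(* This finite sum of indicators serves to show that the number of samples is measurable. *)
have mE z : (m (st z))%:R = \sum_(k < K.+1) (m k)%:R * \1_[set z : Z | st z = k] z :> R.
  have sK : (st z < K.+1)%N by exact: stage_le.
  rewrite (bigD1 (Ordinal sK))//= indicE mem_set// mulr1 big1 ?addr0// => k.
  rewrite -val_eqE/= => ks; rewrite indicE memNset ?mulr0//= => e.
  by rewrite e eqxx in ks.
have mI (B : set Z) : measurable B -> measurable_fun setT (fun z => \1_B z : R).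
  by move=> mB; exact: measurable_indic.
have mW1 (k : nat) : measurable_fun setT (fun z => (m k.+1)%:R * \1_(W k) z : R).
  by apply: measurable_funM => //; exact: mI.
apply: (@le_trans _ _ (\int[iid P \x iid (exp_law R)]_z
    ((m 0)%:R%:E + \sum_(k < K) ((m k.+1)%:R * \1_(W k) z)%:E))%E).
  apply: ge0_le_integral => //.
  - by move=> z _; rewrite /nsamplese/= lee_fin.
  - rewrite [X in measurable_fun _ X](_ : _ = EFin \o (fun z : Z =>
      \sum_(k < K.+1) (m k)%:R * \1_[set z : Z | st z = k] z)).
      apply/measurable_EFinP; apply: measurable_sum => k.
      by apply: measurable_funM => //; apply: mI; exact: measurable_stage.
    by apply/funext => -[x r]/=; rewrite -mE.
  - apply: emeasurable_funD => //; apply: emeasurable_sum => k.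
    by apply/measurable_EFinP; exact: mW1.
  move=> [x r] _; rewrite sumEFin -EFinD lee_fin.
  exact: staged_nsamples_le.
rewrite ge0_integralD//; last 2 first.
- by move=> z _; apply: sume_ge0 => k _; rewrite lee_fin mulr_ge0.
- by apply: emeasurable_sum => k; apply/measurable_EFinP; exact: mW1.
rewrite EFinD leeD//.
  rewrite integral_cst// -[leRHS]mule1 lee_wpmul2l ?lee_fin//.
  exact: (probability_le1 (iid P \x iid (exp_law R))%E).
rewrite ge0_integral_sum//; last by move=> k; apply/measurable_EFinP; exact: mW1.
rewrite -sumEFin; apply: lee_sum => k _.
under eq_integral do rewrite EFinM.
rewrite ge0_integralZl_EFin//; last by apply/measurable_EFinP; exact: mI.
rewrite integral_indic// setIT EFinM lee_wpmul2l ?lee_fin//.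
have mt : measurable_fun setT (fun x => (2 * theta k + total_excess S m theta P k x) / eta).
  apply: measurable_funM => //; apply: measurable_funD => //.
  exact: measurable_total_excess.
have t0 x : 0 <= (2 * theta k + total_excess S m theta P k x) / eta.
  by rewrite divr_ge0 ?(ltW eta0)// addr_ge0 ?total_excess_ge0// mulr_ge0// ltW.
have mN := measurable_near_tie (scaled_score h S eta P) mt.
apply: (@le_trans _ _ ((iid P \x iid (exp_law R))%E [set z : Z |
    near_tie (scaled_score h S eta P)
      ((2 * theta k + total_excess S m theta P k z.1) / eta) z.2])).
  rewrite le_measure ?inE// => -[x r] /=.
  exact: (unresolved_near_tie i0 eta0 theta0 P).
apply: (le_trans (product_near_tie (iid P) _ mt t0)).
by apply: integral_affine_excess; [exact: ltnW|rewrite mulr_ge0// ltW].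
Qed.

Lemma staged_worst_case_samples : worst_case_samples A ((m K)%:R)%:E.
Proof.
move=> x r; rewrite /nsamplese/= lee_fin ler_nat m_nd//.
exact: stage_le.
Qed.

End staged_guarantees.

(** * The exact algorithm and the constant algorithm *)

Section integral_total_excess.
Context (R : realType) d (T : measurableType d) (I : finType) (S : I -> set T).
Hypothesis mS : forall p, measurable (S p).

Lemma integral_total_excess (m : nat -> nat) (theta : nat -> R)
    (P : probability T R) k : 0 < theta k <= 1 -> 32 <= (m k)%:R * theta k ^+ 2 ->
  (\int[iid P]_x (total_excess S m theta P k x)%:E <=
   (#|I|%:R * (theta k * expR (- ((m k)%:R * theta k ^+ 2 / 32))))%:E)%E.
Proof.
move=> t01 h32; rewrite /total_excess; under eq_integral do rewrite -sumEFin.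
rewrite ge0_integral_sum//; last 2 first.
- by move=> p; apply/measurable_EFinP; exact: measurable_excess.
- by move=> p x _; rewrite lee_fin excess_ge0.
have -> : #|I|%:R * (theta k * expR (- ((m k)%:R * theta k ^+ 2 / 32))) =
    \sum_(p : I) (theta k * expR (- ((m k)%:R * theta k ^+ 2 / 32))).
  by rewrite sumr_const mulr_natl.
by rewrite -sumEFin; apply: lee_sum => p _; exact: integral_excess.
Qed.

End integral_total_excess.

Section limit_frequency.
Context (R : realType) d (T : measurableType d) (I : finType) (S : I -> set T).
Hypothesis mS : forall p, measurable (S p).
Local Open Scope classical_set_scope.

(** Sizes 32 * 8^k against thresholds 2^-k make the exponent m theta^2 / 32 equal to 2^k, so the
    tail probabilities are summable. *)
Definition sparse_size k : nat := (32 * 8 ^ k)%N.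
Definition sparse_threshold k : R := 2 ^- k.

Lemma sparse_exponent k :
  (sparse_size k)%:R * sparse_threshold k ^+ 2 / 32 = 2 ^+ k :> R.
Proof.
have e8 : 8 ^+ k = (2 ^+ k) ^+ 3 :> R.
  by rewrite -exprM mulnC exprM; congr (_ ^+ _); ring.
rewrite /sparse_size /sparse_threshold natrM natrX e8.
have : 2 ^+ k != 0 :> R by rewrite expf_neq0// pnatr_eq0.
by move: (2 ^+ k) => a a0; field.
Qed.

Lemma sparse_threshold01 k : 0 < sparse_threshold k <= 1.
Proof.
rewrite /sparse_threshold invr_gt0 exprn_gt0//= invf_le1 ?exprn_gt0//.
by rewrite exprn_ege1// ler1n.
Qed.

(* Sampling along the sparse subsequence of sizes, a Borel-Cantelli argument
   gives almost sure convergence, hence an exact value for the limsup. *)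
Definition limit_frequency p (x : stream T) : R :=
  limn_sup (fun k => empirical R (sparse_size k) (S p) x).

Lemma measurable_limit_frequency p : measurable_fun setT (limit_frequency p).
Proof.
apply: measurable_fun_limn_sup.
- by move=> x _; exists 1 => _ [k _ <-]; exact: empirical_le1.
- by move=> x _; exists 0 => _ [k _ <-]; exact: empirical_ge0.
- by move=> k; exact: measurable_empirical.
Qed.

Variable P : probability T R.

Let bad k := [set x | sparse_threshold k <
  total_excess S sparse_size sparse_threshold P k x].

Lemma limit_frequency_cvg x : ~ lim_sup_set bad x ->
  forall p, limit_frequency p x = fine (P (S p)).
Proof.
move=> /existsNP[N /not_implyP[_ nb]] p.
suff : (fun k => empirical R (sparse_size k) (S p) x : R^o) @ \oo --> (fine (P (S p)) : R^o).
  by move=> /cvg_limn_inf_sup[].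
have c0 : (fun k => 2^-1 ^+ k : R^o) @ \oo --> (0 : R^o).
  by apply: cvg_expr; rewrite ger0_norm//; lra.
apply: (@squeeze_cvgr _ _ _ _ (fun k => fine (P (S p)) - 2^-1 ^+ k) (fun k => fine (P (S p)) + 2^-1 ^+ k)).
- near=> k.
  have Nk : (N <= k)%N by near: k; exact: nbhs_infty_ge.
  have : ~ bad k x by move=> b; apply: nb; exists k.
  move=> /negP; rewrite -leNgt => hk.
  have := deviation_le S sparse_size sparse_threshold P k x p.
  move: hk; rewrite /sparse_threshold exprVn ler_norml => hk /andP[h1 h2].
  by apply/andP; split; lra.
- rewrite -[X in _ --> X]subr0; apply: cvgB => //; exact: cvg_cst.
- rewrite -[X in _ --> X]addr0; apply: cvgD => //; exact: cvg_cst.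
Unshelve. all: by end_near. Qed.

Lemma iid_bad0 : iid P (lim_sup_set bad) = 0%E.
Proof.
have mbad k : measurable (bad k).
  by apply: measurable_lt_set => //; exact: measurable_total_excess.
apply: lim_sup_set_cvg0 => //.
(* In Markov's inequality the threshold cancels and leaves [#|I|] exp(- 2^k). The majorant [#|I|] /
   2^k is written in the form summed by [epsilon_trick0]. *)
apply: (@le_lt_trans _ _ (\sum_(0 <= k <oo) ((2 * #|I|%:R) / (2 ^ k.+1)%:R : R)%:E)%E); last first.
  by apply: (le_lt_trans (epsilon_trick0 xpredT _)); rewrite ?ltry// mulr_ge0.
apply: lee_nneseries => [//|k _].
have /andP[t0 t1] := sparse_threshold01 k.
apply: (le_trans (probability_gt_le (Q := iid P) t0 (measurable_total_excess mS _ _ P k)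
  (total_excess_ge0 _ _ _ P k) (integral_total_excess mS P (sparse_threshold01 k) _))).
  have := sparse_exponent k.
  have : 1 <= 2 ^+ k :> R by rewrite exprn_ege1// ler1n.
  lra.
rewrite sparse_exponent lee_fin ler_pdivrMr// natrX exprS /sparse_threshold.
have : 0 < 2 ^+ k :> R by rewrite exprn_gt0.
move: (2 ^+ k) => a a0.
have -> : 2 * #|I|%:R / (2 * a) / a = #|I|%:R * (a^-1 * a^-1) :> R.
  by field; rewrite gt_eqF.
rewrite ler_wpM2l// ler_pM2l ?invr_gt0// expRN lef_pV2 ?posrE ?expR_gt0//.
by have := expR_ge1Dx a; lra.
Qed.

End limit_frequency.

Section constant_algorithm.
Context (R : realType) d (T : measurableType d) (n : nat) (i0 : 'I_n).
Local Open Scope classical_set_scope.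

Let constant_output (x : stream T) (r : measurableTypeR R) := i0.
Let constant_nsamples (x : stream T) (r : measurableTypeR R) := Some 0%N.

Let constant_prefix x y r k : constant_nsamples x r = Some k ->
  (forall j, (j < k)%N -> x j = y j) ->
  constant_nsamples y r = Some k /\ constant_output y r = constant_output x r.
Proof. by []. Qed.

(** Serves the case of a single hypothesis, where [ln n = 0] allows no sample at all. *)
Definition constant_algorithm : algorithm R T n :=
  @Algorithm R d T n _ (measurableTypeR R) (exp_law R) constant_output constant_nsamples
    (fun i => measurable_constprop _ (i0 = i)) (fun k => measurable_constprop _ (Some 0%N = Some k))
    constant_prefix.

Lemma constant_replicable (rho : R) : 0 <= rho -> replicable rho constant_algorithm.
Proof.
move=> rho0 P.
rewrite (_ : [set z | _] = setT); last by apply/seteqP; split.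
rewrite (_ : ((iid P \x iid P) \x exp_law R)%E setT = 1%E).
  by rewrite lee_fin lerBlDr lerDl.
exact: (probability_setT ((iid P \x iid P) \x exp_law R)%E).
Qed.

End constant_algorithm.

Section unlimited_selection.
Context (R : realType) d (T : measurableType d) (n : nat) (i0 : 'I_n).
Variables (H : 'I_n -> probability T R) (S : 'I_n * 'I_n -> set T).
Hypothesis mS : forall p, measurable (S p).
Hypothesis scheffeS : forall p A, measurable A ->
  `|fine (H p.1 A) - fine (H p.2 A)| <= `|fine (H p.1 (S p)) - fine (H p.2 (S p))|.
Local Open Scope classical_set_scope.

Let best (x : stream T) := argmin i0 (fun i =>
  score (hypotheses_on H S) (fun p => limit_frequency R S p x) i).

Let measurable_best i : measurable [set x | best x = i].
Proof.
apply: measurable_argmin => j; apply: measurable_score => p.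
exact: measurable_limit_frequency.
Qed.

Let unlimited_output (x : stream T) (r : measurableTypeR R) := best x.
Let unlimited_nsamples (x : stream T) (r : measurableTypeR R) : option nat := None.

Let measurable_unlimited_output i :
  measurable [set z : stream T * measurableTypeR R | unlimited_output z.1 z.2 = i].
Proof.
have := @measurable_fst _ _ (stream T) (measurableTypeR R) measurableT _ (measurable_best i).
by rewrite setTI.
Qed.

Let unlimited_prefix x y r k : unlimited_nsamples x r = Some k ->
  (forall j, (j < k)%N -> x j = y j) ->
  unlimited_nsamples y r = Some k /\ unlimited_output y r = unlimited_output x r.
Proof. by []. Qed.

Definition unlimited_algorithm : algorithm R T n :=
  @Algorithm R d T n _ (measurableTypeR R) (exp_law R) unlimited_output unlimited_nsamples
    measurable_unlimited_output (fun k => measurable_constprop _ (None = Some k))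
    unlimited_prefix.

Let bad (P : probability T R) :=
  [set x | exists p, ~ (limit_frequency R S p x = fine (P (S p)))].

Let measurable_bad P : measurable (bad P).
Proof.
apply: measurable_exists => p.
have ml : measurable_fun setT (limit_frequency R S p) by exact: measurable_limit_frequency.
rewrite (_ : [set x | _] = ~` [set x | limit_frequency R S p x <= fine (P (S p)) /\
    fine (P (S p)) <= limit_frequency R S p x]).
  by apply: measurableC; apply: measurable_and2; apply: measurable_le_set.
apply/seteqP; split => x /= h; last by move=> e; apply: h; rewrite e.
by move=> [h1 h2]; apply: h; apply/eqP; rewrite eq_le h1.
Qed.

Let iid_bad P : (iid P (bad P) <= 0)%E.
Proof.
rewrite -(iid_bad0 mS P) le_measure ?inE//.
- apply: bigcap_measurableType => k _; apply: bigcup_measurable => j _.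
  by apply: measurable_lt_set => //; exact: measurable_total_excess.
- move=> x [p hp]; apply: contrapT => nb; apply: hp.
  exact: limit_frequency_cvg.
Qed.

Let not_bad P x : ~ bad P x -> forall p, limit_frequency R S p x = fine (P (S p)).
Proof. by move=> nb p; apply: contrapT => np; apply: nb; exists p. Qed.

(** Off a null set the output is a function of [P] alone, so two runs agree almost surely. *)
Let best_ideal P x : ~ bad P x -> best x =
  argmin i0 (fun i => score (hypotheses_on H S) (fun p => fine (P (S p))) i).
Proof.
move=> /not_bad nb; rewrite /best; congr (argmin i0 _); apply/funext => i.
by congr (score _ _ i); apply/funext => p; exact: nb.
Qed.

Lemma unlimited_replicable (rho : R) : 0 <= rho -> replicable rho unlimited_algorithm.
Proof.
move=> rho0 P.
apply: (@le_trans _ _ (1 - 0)%:E); first by rewrite lee_fin lerD2l lerN2.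
pose B1 := [set y : stream T * stream T | bad P y.1].
pose B2 := [set y : stream T * stream T | bad P y.2].
have mB1 : measurable B1.
  by have := @measurable_fst _ _ (stream T) (stream T) measurableT _ (measurable_bad P); rewrite setTI.
have mB2 : measurable B2.
  by have := @measurable_snd _ _ (stream T) (stream T) measurableT _ (measurable_bad P); rewrite setTI.
have mB12 : measurable (B1 `|` B2) by exact: measurableU.
have mB : measurable [set z : (stream T * stream T) * measurableTypeR R | (B1 `|` B2) z.1].
  have := @measurable_fst _ _ (stream T * stream T)%type (measurableTypeR R) measurableT _ mB12.
  by rewrite setTI.
apply: (product_probability_ge _ mB).
- rewrite (_ : [set z | _] = [set z : (stream T * stream T) * measurableTypeR R |
      exists i, best z.1.1 = i /\ best z.1.2 = i]).
    apply: measurable_exists => i.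
    apply: measurable_and2.
      have := measurableT_comp (@measurable_fst _ _ (stream T) (stream T))
        (@measurable_fst _ _ (stream T * stream T)%type (measurableTypeR R)) measurableT (measurable_best i).
      by rewrite setTI.
    have := measurableT_comp (@measurable_snd _ _ (stream T) (stream T))
      (@measurable_fst _ _ (stream T * stream T)%type (measurableTypeR R)) measurableT (measurable_best i).
    by rewrite setTI.
  apply/seteqP; split => [z e|z [i [e1 e2]]]; last exact (etrans e1 (esym e2)).
  by exists (best z.1.1); split; [reflexivity|exact (esym e)].
- move=> [[x y] r] nB.
  have nx : ~ bad P x by move=> b; apply: nB; left.
  have ny : ~ bad P y by move=> b; apply: nB; right.
  exact (etrans (best_ideal nx) (esym (best_ideal ny))).
rewrite [leLHS](product_fst (iid P \x iid P)%E (exp_law R) mB12).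
apply: (le_trans (measureU2 (iid P \x iid P)%E mB1 mB2)).
rewrite -[leRHS]adde0; apply: leeD.
  by rewrite [leLHS](product_fst (iid P) (iid P) (measurable_bad P)); exact: iid_bad.
by rewrite [leLHS](product_snd (iid P) (iid P) (measurable_bad P)); exact: iid_bad.
Qed.

Lemma unlimited_selects (eps fail : R) : 0 <= eps -> 0 <= fail ->
  selects H 3 eps fail unlimited_algorithm.
Proof.
move=> eps0 fail0 P.
apply: (@le_trans _ _ (1 - 0)%:E); first by rewrite lee_fin lerD2l lerN2.
have mB : measurable [set z : stream T * measurableTypeR R | bad P z.1].
  have := @measurable_fst _ _ (stream T) (measurableTypeR R) measurableT _ (measurable_bad P).
  by rewrite setTI.
apply: (product_probability_ge _ mB).
- rewrite (_ : [set z | _] = [set z : stream T * measurableTypeR R | exists i, best z.1 = i /\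
      (dTV (H i) P <= 3%:E * (\big[mine/+oo]_(j < n) dTV (H j) P) + eps%:E)%E]).
    apply: measurable_exists => i; apply: measurable_and2; last exact: measurable_constprop.
    exact: measurable_unlimited_output.
  apply/seteqP; split => [z e|z [i [e]]]; last by rewrite -e.
  by exists (best z.1); split; [reflexivity|exact e].
- move=> [x r] nB.
  have nx : ~ bad P x by move=> b; apply: nB.
  apply: (minimum_distance_select mS scheffeS) => j.
  have := argminP i0
    (fun i => score (hypotheses_on H S) (fun p => fine (P (S p))) i) j.
  rewrite -(best_ideal nx) => h.
  by apply: (le_trans h); rewrite lerDl.
by rewrite [leLHS](product_fst (iid P) (exp_law R) (measurable_bad P)); exact: iid_bad.
Qed.

End unlimited_selection.

(** * Choice of parameters *)

Section parameters.
Context (R : realType).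

Lemma sum_reversed_geometric_le2 (q : R) K : 0 <= q <= 2^-1 ->
  \sum_(k < K.+1) q ^+ (K - k) <= 2.
Proof.
move=> /andP[q0 q1]; elim: K => [|K IH].
  by rewrite big_ord1 expr0 ler1n.
rewrite big_ord_recr/= subnn expr0.
have -> : \sum_(i < K.+1) q ^+ (K.+1 - i) = q * \sum_(i < K.+1) q ^+ (K - i).
  by rewrite mulr_sumr; apply: eq_bigr => i _; rewrite subSn ?exprS// -ltnS.
have := ler_pM q0 (sumr_ge0 _ (fun (i : 'I_K.+1) _ => exprn_ge0 (K - i) q0)) q1 IH.
lra.
Qed.

Lemma sum_geometric_3half K : \sum_(k < K) (3 / 2) ^+ k <= 2 * (3 / 2) ^+ K :> R.
Proof.
elim: K => [|K IH]; first by rewrite big_ord0 expr0 mulr1.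
by rewrite big_ord_recr/= exprS; lra.
Qed.

(** The lower bound makes the last margin at most eta rho / 8, for replicability; the upper one
    turns powers of 2^K into powers of 1 / rho in the sample counts. *)
Lemma doubling_exponent (rho : R) : 0 < rho <= 1 ->
  exists K, 8 / rho <= 2 ^+ K <= 16 / rho.
Proof.
move=> /andP[r0 r1].
have ex : exists k, 8 / rho <= 2 ^+ k.
  exists (Num.truncn (8 / rho)).+1; apply: ltW; apply: (lt_le_trans (truncnS_gt _)).
  by rewrite -natrX ler_nat ltnW// ltn_expl.
case: (ex_minnP ex) => K hK Kmin; exists K; rewrite hK/=.
case: K hK Kmin => [|K] hK Kmin.
  by move: hK; rewrite expr0 ler_pdivrMr//; lra.
have : ~~ (8 / rho <= 2 ^+ K) by apply/negP => /Kmin; rewrite ltnn.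
rewrite -ltNge exprS => h.
have -> : 16 / rho = 2 * (8 / rho) by ring.
by rewrite ler_pM2l// ltW.
Qed.

(** exp(1/2) <= 2 follows from exp(- 1/2) >= 1/2. A bound away from 0 lets lower powers of ln n be
    absorbed in higher ones. *)
Lemma ln_nat_ge_half n : (1 < n)%N -> 2^-1 <= ln n%:R :> R.
Proof.
move=> n1; have n0 : 0 < n%:R :> R by rewrite ltr0n ltnW.
rewrite -ler_expR lnK ?posrE//.
have h := expR_ge1Dx (- 2^-1 : R); have e0 := expR_gt0 (2^-1 : R).
rewrite expRN in h.
apply: (@le_trans _ _ 2); last by rewrite ler_nat.
have : (1 - 2^-1) * expR (2^-1 : R) <= 1 by rewrite -ler_pdivlMr// div1r.
lra.
Qed.

Context (c n : nat) (eps : R) (K : nat).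
Hypothesis n1 : (1 < n)%N.
Hypothesis eps01 : 0 < eps <= 1.

(* With L = log_budget, K about log2 (8 / rho), theta_k = stage_margin k and
   m_k = stage_size k, the exponent m_k theta_k^2 / 32 is at least
   L (4/3)^(K-k): earlier stages are more reliable than needed at their own
   scale, which pays for the factor 1 / rho without a log (1 / rho), while
   theta_k m_k grows geometrically, so the expected cost is that of the last
   stage. *)
Definition log_budget : R := (c + 6)%:R * ln n%:R.
Definition noise_scale : R := eps / (2 * log_budget).
Definition base_size : nat :=
  (Num.truncn (32 * log_budget * (4 / 3) ^+ K / noise_scale ^+ 2)).+1.
Definition stage_size k : nat := (base_size * 3 ^ k)%N.
Definition stage_margin k : R := noise_scale / 2 ^+ k.
Definition stage_error k : R := (n * n)%:R *
  (stage_margin k * expR (- ((stage_size k)%:R * stage_margin k ^+ 2 / 32))).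

Let U := log_budget.
Let eta := noise_scale.

Lemma log_budget_ge3 : 3 <= U.
Proof.
have h := ln_nat_ge_half n1.
have h6 : 6 <= (c + 6)%:R :> R by rewrite ler_nat leq_addl.
rewrite /U /log_budget; nra.
Qed.

Lemma noise_scale_bounds : [/\ 0 < eta, eta <= 1 & 2 * eta * U = eps].
Proof.
have U3 := log_budget_ge3; move: eps01 => /andP[e0 e1].
have U0 : 0 < U by lra.
split.
- by rewrite /eta /noise_scale -/U divr_gt0//; exact: mulr_gt0.
- by rewrite /eta /noise_scale -/U ler_pdivrMr; [lra|exact: mulr_gt0].
- by rewrite /eta /noise_scale -/U; move: U U0 => V V0; field; rewrite gt_eqF.
Qed.

Lemma stage_margin_gt0 k : 0 < stage_margin k.
Proof. by have [e0 _ _] := noise_scale_bounds; rewrite divr_gt0// exprn_gt0. Qed.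

Lemma stage_margin_le k : stage_margin k <= eta.
Proof.
have [e0 _ _] := noise_scale_bounds.
by rewrite /stage_margin ler_pdivrMr ?exprn_gt0// ler_peMr ?(ltW e0)// exprn_ege1// ler1n.
Qed.

Lemma base_size_bounds :
  32 * U * (4 / 3) ^+ K / eta ^+ 2 <= base_size%:R <=
  64 * U * (4 / 3) ^+ K / eta ^+ 2.
Proof.
have [e0 e1 _] := noise_scale_bounds; have U3 := log_budget_ge3.
rewrite /base_size -/U -/eta; set y := 32 * U * _ / _.
(* Rounding by integer part plus one costs at most a factor 2 because [y] is at least 1. *)
have y1 : 1 <= y.
  rewrite /y ler_pdivlMr ?exprn_gt0// mul1r.
  have h1 : eta ^+ 2 <= 1 by rewrite exprn_ile1// ltW.
  have h2 : 1 <= (4 / 3) ^+ K :> R by rewrite exprn_ege1//; lra.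
  nra.
have -> : 64 * U * (4 / 3) ^+ K / eta ^+ 2 = y + y by rewrite /y; ring.
have y0 : 0 <= y by lra.
rewrite (ltW (truncnS_gt _))/= -natr1 lerD// truncn_le//.
Qed.

Lemma stage_exponent k : (k <= K)%N ->
  U * (1 + (K - k)%:R / 3) <= (stage_size k)%:R * stage_margin k ^+ 2 / 32.
Proof.
move=> kK; have [e0 e1 _] := noise_scale_bounds; have U3 := log_budget_ge3.
have /andP[h _] := base_size_bounds.
(* Bernoulli's inequality: linear growth of the exponent already gives geometric decay of the
   errors. *)
have bern j : 1 + j%:R / 3 <= (4 / 3) ^+ j :> R.
  elim: j => [|j IH]; first by rewrite expr0 mul0r addr0.
  rewrite exprS -natr1.
  have : 0 <= j%:R :> R by [].
  lra.
apply: (@le_trans _ _ (U * (4 / 3) ^+ (K - k))).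
  by rewrite ler_wpM2l ?bern//; lra.
have -> : (stage_size k)%:R * stage_margin k ^+ 2 / 32 =
    base_size%:R * eta ^+ 2 / 32 * (3 / 4) ^+ k.
  have e4 : 2 ^+ k * 2 ^+ k = 4 ^+ k :> R by rewrite -exprMn; congr (_ ^+ _); ring.
  rewrite (expr_div_n 3 4 k) -e4 /stage_size /stage_margin natrM natrX -/eta.
  by field; rewrite expf_neq0// pnatr_eq0.
have -> : U * (4 / 3) ^+ (K - k) = 32 * U * (4 / 3) ^+ K / eta ^+ 2 * eta ^+ 2 / 32 * (3 / 4) ^+ k.
  have -> : (4 / 3) ^+ K = (4 / 3) ^+ (K - k) * (4 / 3) ^+ k :> R.
    by rewrite -exprD subnK.
  have e1' : (4 / 3) ^+ k * (3 / 4) ^+ k = 1 :> R.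
    by rewrite -exprMn -[RHS](expr1n _ k); congr (_ ^+ _); field.
  transitivity (U * (4 / 3) ^+ (K - k) * ((4 / 3) ^+ k * (3 / 4) ^+ k)).
    by rewrite e1' mulr1.
  by field; rewrite gt_eqF.
have q0 : 0 <= (3 / 4) ^+ k :> R by apply: exprn_ge0; lra.
apply: ler_wpM2r => //; rewrite ler_pM2r ?invr_gt0//.
by apply: ler_wpM2r => //; rewrite exprn_ge0// ltW.
Qed.

Lemma stage_exponent_ge1 k : (k <= K)%N ->
  32 <= (stage_size k)%:R * stage_margin k ^+ 2.
Proof.
move=> /stage_exponent h; have U3 := log_budget_ge3.
have h2 : 0 <= (K - k)%:R :> R by [].
nra.
Qed.

(** With j = K - k, the exponent [U * (1 + j / 3)] is at least (c + 6) ln n + 2 j ln n, because (c +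
    6) / 3 >= 2. Two powers of n then pay for the n^2 Scheffe sets, and n^(-2 j) <= 4^-j. *)
Lemma stage_error_le k : (k <= K)%N ->
  stage_error k <= stage_margin k * (n%:R^-1 ^+ (c + 4) * 4^-1 ^+ (K - k)).
Proof.
move=> kK; have t0 := stage_margin_gt0 k; have U3 := log_budget_ge3.
have n0 : 0 < n%:R :> R by rewrite ltr0n ltnW.
rewrite /stage_error mulrCA ler_pM2l//.
have eL j : expR (- (j%:R * ln n%:R)) = n%:R^-1 ^+ j :> R.
  by rewrite expRN expRM_natl lnK ?posrE// exprVn.
have h1 : expR (- ((stage_size k)%:R * stage_margin k ^+ 2 / 32)) <=
    n%:R^-1 ^+ (c + 6) * n%:R^-1 ^+ (2 * (K - k)).
  rewrite -exprD -eL ler_expR lerN2.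
  apply: le_trans (stage_exponent kK); rewrite /U /log_budget.
  have l0 := ln_nat_ge_half n1.
  have h6 : 6 <= (c + 6)%:R :> R by rewrite ler_nat leq_addl.
  have hj : 0 <= (K - k)%:R :> R by [].
  rewrite natrD natrM -subr_ge0.
  rewrite (_ : _ - _ = (K - k)%:R * ln n%:R * ((c + 6)%:R / 3 - 2)); last by field.
  by rewrite mulr_ge0// ?mulr_ge0//; lra.
apply: (le_trans (ler_wpM2l _ h1)) => //.
have c6 : (c + 6 = c + 4 + 2)%N by rewrite -addnA.
rewrite (exprM _ 2) c6 (exprD _ (c + 4)).
rewrite natrM.
have -> : n%:R * n%:R * (n%:R^-1 ^+ (c + 4) * n%:R^-1 ^+ 2 * (n%:R^-1 ^+ 2) ^+ (K - k)) =
   n%:R^-1 ^+ (c + 4) * (n%:R^-1 ^+ 2) ^+ (K - k) :> R.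
  by move: (n%:R^-1 ^+ (c + 4)) ((n%:R^-1 ^+ 2) ^+ (K - k)) => a b; field; rewrite gt_eqF.
rewrite ler_wpM2l ?exprn_ge0 ?invr_ge0//.
rewrite lerXn2r ?nnegrE ?exprn_ge0 ?invr_ge0//.
have -> : 4^-1 = 2^-1 ^+ 2 :> R by field.
by rewrite lerXn2r ?nnegrE ?invr_ge0// lef_pV2 ?posrE// ler_nat.
Qed.

Lemma inverse_n_power_le j : n%:R^-1 ^+ j <= 2^-1 ^+ j :> R.
Proof.
have n0 : 0 < n%:R :> R by rewrite ltr0n ltnW.
by rewrite lerXn2r ?nnegrE ?invr_ge0// lef_pV2 ?posrE// ler_nat.
Qed.

Lemma stage_error_le_margin k : (k <= K)%N -> stage_error k <= stage_margin k.
Proof.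
move=> kK; apply: (le_trans (stage_error_le kK)).
rewrite ler_piMr ?(ltW (stage_margin_gt0 k))//.
rewrite mulr_ile1 ?exprn_ge0 ?invr_ge0//.
  by rewrite exprn_ile1 ?invr_ge0// invf_le1 ?ler1n ?ltr0n ltnW.
by rewrite exprn_ile1 ?invr_ge0//; lra.
Qed.

(** Going back j stages from [K] multiplies the margin by 2^j but the relative error by 4^-j, so the
    bounds form a geometric series of ratio 1/2; n^-(c + 4) <= 1/16 gives the constant. *)
Lemma sum_stage_error : \sum_(k < K.+1) stage_error k <= stage_margin K / 8.
Proof.
have t0 := stage_margin_gt0 K.
apply: (@le_trans _ _ (\sum_(k < K.+1) stage_margin K / 16 * 2^-1 ^+ (K - k))).
  apply: ler_sum => k _; have kK : (k <= K)%N by rewrite -ltnS.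
  apply: (le_trans (stage_error_le kK)).
  have -> : stage_margin k = stage_margin K * 2 ^+ (K - k).
    have e : 2 ^+ K = 2 ^+ (K - k) * 2 ^+ k :> R by rewrite -exprD subnK.
    rewrite /stage_margin e.
    by field; rewrite !expf_neq0// pnatr_eq0.
  have -> : stage_margin K / 16 * 2^-1 ^+ (K - k) =
      stage_margin K * 2 ^+ (K - k) * (2^-1 ^+ 4 * 4^-1 ^+ (K - k)).
    have -> : 2^-1 ^+ (K - k) = 2 ^+ (K - k) * 4^-1 ^+ (K - k) :> R.
      by rewrite -exprMn; congr (_ ^+ _); field.
    by field.
  apply: ler_wpM2l; first by rewrite mulr_ge0 ?exprn_ge0 ?(ltW t0).
  apply: ler_wpM2r; first by rewrite exprn_ge0 ?invr_ge0.
  apply: (le_trans (inverse_n_power_le _)); rewrite exprD.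
  by rewrite ler_piMl ?exprn_ge0 ?invr_ge0// exprn_ile1 ?invr_ge0//; lra.
rewrite -mulr_sumr.
have h : 0 <= (2^-1 : R) <= 2^-1 by rewrite lexx invr_ge0 ler0n.
have := ler_wpM2l (ltW t0) (sum_reversed_geometric_le2 K h).
lra.
Qed.

(** The noise term is n^-(c + 5) <= n^-c / 32, and the geometric sum over the stages is at most 2
    n^-(c + 4) <= n^-c / 8. *)
Lemma sum_failure : n%:R * expR (- U) + \sum_(k < K.+1) stage_error k / stage_margin k <=
  n%:R ^- c.
Proof.
have n0 : 0 < n%:R :> R by rewrite ltr0n ltnW.
have -> : expR (- U) = n%:R^-1 ^+ (c + 6).
  by rewrite /U /log_budget expRN expRM_natl lnK ?posrE// exprVn.
have e1 : n%:R * n%:R^-1 ^+ (c + 6) = n%:R^-1 ^+ c * n%:R^-1 ^+ 5 :> R.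
  rewrite !exprD; move: (n%:R^-1 ^+ c) => a.
  by field; rewrite gt_eqF.
have s1 : \sum_(k < K.+1) stage_error k / stage_margin k <=
    \sum_(k < K.+1) n%:R^-1 ^+ (c + 4) * 4^-1 ^+ (K - k).
  apply: ler_sum => k _; have kK : (k <= K)%N by rewrite -ltnS.
  by rewrite ler_pdivrMr ?stage_margin_gt0// mulrC stage_error_le.
rewrite -mulr_sumr in s1.
have h4 : 0 <= (4^-1 : R) <= 2^-1 by apply/andP; split; lra.
have a0 : 0 <= n%:R^-1 ^+ (c + 4) :> R by rewrite exprn_ge0 ?invr_ge0.
have s2 := ler_wpM2l a0 (sum_reversed_geometric_le2 K h4).
have := inverse_n_power_le 5; have := inverse_n_power_le 4.
rewrite e1; rewrite exprD in s1 s2; rewrite -exprVn.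
have : 0 <= n%:R^-1 ^+ c :> R by rewrite exprn_ge0 ?invr_ge0.
move: s1 s2; move: (\sum_(k < K.+1) stage_error k / stage_margin k) (\sum_(k < K.+1) _).
move: (n%:R^-1 ^+ c) (n%:R^-1 ^+ 4) (n%:R^-1 ^+ 5) => a b e s s' h1 h2 h3 h5 h6.
have f1 := ler_wpM2l h3 h5; have f2 := ler_wpM2l h3 h6.
have g4 : 2^-1 ^+ 4 = 1 / 16 :> R by field.
have g5 : 2^-1 ^+ 5 = 1 / 32 :> R by field.
rewrite g4 in f1; rewrite g5 in f2.
lra.
Qed.

Context (rho : R).
Hypothesis rho01 : 0 < rho <= 1.
Hypothesis hK : 8 / rho <= 2 ^+ K <= 16 / rho.

Lemma stage_replicability :
  2 * (stage_margin K + \sum_(k < K.+1) stage_error k) <= eta * rho.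
Proof.
have [e0 _ _] := noise_scale_bounds; move: rho01 hK => /andP[r0 _] /andP[h _].
have t : stage_margin K <= eta * rho / 8.
  rewrite /stage_margin -/eta -mulrA ler_pM2l//.
  rewrite ler_pdivrMr// in h.
  have X0 : 0 < 2 ^+ K :> R by rewrite exprn_gt0.
  by rewrite -[leLHS]mul1r ler_pdivrMr//; lra.
have := sum_stage_error; have := mulr_gt0 e0 r0; lra.
Qed.

(** The sizes carry only three logarithms; 4 (ln n)^2 >= 1 raises them to five. *)
Lemma log_budget_cube : U ^+ 3 <= 4 * (c + 6)%:R ^+ 3 * ln n%:R ^+ 5.
Proof.
have l := ln_nat_ge_half n1.
have l2 : 4^-1 <= ln n%:R ^+ 2 :> R.
  by rewrite expr2; nra.
have l3 : 0 <= ln n%:R ^+ 3 :> R by rewrite exprn_ge0//; lra.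
have c3 : 0 <= (c + 6)%:R ^+ 3 :> R by rewrite exprn_ge0.
rewrite /U /log_budget exprMn -[5%N]/(3 + 2)%N exprD.
have -> : 4 * (c + 6)%:R ^+ 3 * (ln n%:R ^+ 3 * ln n%:R ^+ 2) =
  (c + 6)%:R ^+ 3 * ln n%:R ^+ 3 * (4 * ln n%:R ^+ 2) :> R by ring.
by rewrite ler_peMr ?mulr_ge0//; lra.
Qed.

Let X0 : 0 < 2 ^+ K :> R. Proof. by rewrite exprn_gt0. Qed.

(** (4/3)^K 3^K = 4^K <= (16 / rho)^2, and 1 / eta^2 = 4 U^2 / eps^2 supplies two of the three
    factors U. *)
Lemma stage_size_max : (stage_size K)%:R <= 64 * 4 * 256 * U ^+ 3 / (eps ^+ 2 * rho ^+ 2).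
Proof.
have [e0 _ eU] := noise_scale_bounds; have U3 := log_budget_ge3.
move: rho01 hK => /andP[r0 _] /andP[_ h].
have /andP[_ b] := base_size_bounds.
rewrite /stage_size natrM natrX.
apply: (@le_trans _ _ (64 * U * (4 / 3) ^+ K / eta ^+ 2 * 3 ^+ K)).
  by rewrite ler_wpM2r// exprn_ge0.
have e4 : (4 / 3) ^+ K * 3 ^+ K = (2 ^+ K) ^+ 2 :> R.
  by rewrite -exprMn -exprM mulnC exprM; congr (_ ^+ _); field.
have -> : 64 * U * (4 / 3) ^+ K / eta ^+ 2 * 3 ^+ K = 64 * U / eta ^+ 2 * (2 ^+ K) ^+ 2.
  by rewrite -e4; ring.
have -> : 64 * 4 * 256 * U ^+ 3 / (eps ^+ 2 * rho ^+ 2) = 64 * U / eta ^+ 2 * (16 / rho) ^+ 2.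
  by rewrite -eU; field; rewrite !gt_eqF//; lra.
rewrite ler_wpM2l//; last by rewrite lerXn2r ?nnegrE ?(ltW X0)// divr_ge0// ltW.
by rewrite divr_ge0 ?exprn_ge0 ?(ltW e0)//; lra.
Qed.

(** Each summand is at most 9 (3/2)^k times [base_size]: one 3 from the next size, one from 2 theta
    + delta <= 3 theta. The sum gives 18 and the first stage 1, hence 19. As (4/3)^K (3/2)^K = 2^K,
    a single factor 1 / rho remains. *)
Lemma stage_size_expected :
  (stage_size 0)%:R + \sum_(k < K) (stage_size k.+1)%:R *
     ((2 * stage_margin k + stage_error k) / eta) <=
  19 * 64 * 4 * 16 * U ^+ 3 / (eps ^+ 2 * rho).
Proof.
have [e0 _ eU] := noise_scale_bounds; have U3 := log_budget_ge3.
move: rho01 hK => /andP[r0 _] /andP[_ h].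
have /andP[_ b] := base_size_bounds.
have b0 : 0 <= base_size%:R :> R by [].
have s1 : \sum_(k < K) (stage_size k.+1)%:R *
     ((2 * stage_margin k + stage_error k) / eta) <=
     9 * base_size%:R * \sum_(k < K) (3 / 2) ^+ k.
  rewrite mulr_sumr; apply: ler_sum => k _.
  have kK : (k <= K)%N by exact: ltnW.
  apply: (@le_trans _ _ ((stage_size k.+1)%:R * (3 * stage_margin k / eta))).
    rewrite ler_wpM2l// ler_pM2r ?invr_gt0//.
    by have := stage_error_le_margin kK; lra.
  rewrite /stage_size /stage_margin -/eta natrM natrX exprS expr_div_n le_eqVlt.
  apply/orP; left; apply/eqP; field.
  by rewrite (gt_eqF e0) expf_neq0// pnatr_eq0.
have s2 := ler_wpM2l (mulr_ge0 (ler0n R 9) b0) (sum_geometric_3half K).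
have x1 : 1 <= (3 / 2) ^+ K :> R by rewrite exprn_ege1//; lra.
have s3 := ler_wpM2l b0 x1.
have -> : (stage_size 0)%:R = base_size%:R :> R by rewrite /stage_size expn0 muln1.
apply: (@le_trans _ _ (19 * (base_size%:R * (3 / 2) ^+ K))).
  rewrite mulr1 in s3.
  by move: s1 s2 s3; move: (\sum_(k < K) _) (\sum_(k < K) _) => *; lra.
have e2 : (4 / 3) ^+ K * (3 / 2) ^+ K = 2 ^+ K :> R.
  by rewrite -exprMn; congr (_ ^+ _); field.
apply: (@le_trans _ _ (19 * (64 * U * (4 / 3) ^+ K / eta ^+ 2 * (3 / 2) ^+ K))).
  by rewrite ler_wpM2l// ler_wpM2r//; lra.
have -> : 19 * (64 * U * (4 / 3) ^+ K / eta ^+ 2 * (3 / 2) ^+ K) =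
    19 * 64 * U / eta ^+ 2 * 2 ^+ K.
  by rewrite -e2; ring.
have -> : 19 * 64 * 4 * 16 * U ^+ 3 / (eps ^+ 2 * rho) = 19 * 64 * U / eta ^+ 2 * (16 / rho).
  by rewrite -eU; field; rewrite !gt_eqF//; lra.
by rewrite ler_wpM2l// divr_ge0 ?exprn_ge0 ?(ltW e0)//; lra.
Qed.

End parameters.

Section bounded_sampling.
Context (R : realType) (c : nat) d (T : measurableType d) (n : nat).
Variables (H : 'I_n -> probability T R) (eps rho : R).
Hypothesis n1 : (1 < n)%N.
Hypothesis eps01 : 0 < eps <= 1.
Hypothesis rho01 : 0 < rho <= 1.

Lemma bounded_selection : exists A : algorithm R T n,
  [/\ replicable rho A,
      selects H 3 eps (n%:R ^- c) A,
      worst_case_samples A (64 * 4 * 256 * log_budget R c n ^+ 3 / (eps ^+ 2 * rho ^+ 2))%:E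
    & expected_samples A (19 * 64 * 4 * 16 * log_budget R c n ^+ 3 / (eps ^+ 2 * rho))%:E].
Proof.
have [S mS scheffeS] := scheffe_family H.
have [K hK] := doubling_exponent rho01.
have [e0 e1 eU] := noise_scale_bounds c n1 eps01.
have U3 := log_budget_ge3 R c n1.
pose i0 : 'I_n := Ordinal (ltnW n1).
pose m := stage_size c n eps K.
pose theta := stage_margin c n eps.
pose delta := stage_error c n eps K.
have m_nd : {homo m : i j / (i <= j)%N}.
  by move=> i j ij; rewrite /m /stage_size leq_mul2l leq_pexp2l// orbT.
have theta0 k : 0 < theta k := stage_margin_gt0 c n1 eps01 k.
have hd (P : probability T R) k : (k <= K)%N ->
    (\int[iid P]_x (total_excess S m theta P k x)%:E <= (delta k)%:E)%E.
  move=> kK; rewrite /delta /stage_error.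
  have -> : (n * n)%N = #|{: 'I_n * 'I_n}| by rewrite card_prod card_ord.
  apply: integral_total_excess => //.
    by rewrite theta0/= (le_trans (stage_margin_le c n1 eps01 k)).
  exact: stage_exponent_ge1.
exists (staged_algorithm i0 (hypotheses_on H S) mS (noise_scale c n eps) K theta m_nd).
split.
- apply: (staged_replicable i0 H mS e0 m_nd theta0 hd).
  exact: stage_replicability.
- apply: (staged_selects i0 mS scheffeS e0 m_nd theta0 hd (U := log_budget R c n)).
  + by lra.
  + move=> k _; have := stage_margin_le c n1 eps01 k; rewrite -/(theta k).
    have : noise_scale c n eps * 3 <= noise_scale c n eps * log_budget R c n.
      by rewrite ler_pM2l.
    lra.
  + exact: sum_failure.
- move=> x r.
  apply: (le_trans (staged_worst_case_samples x r)).
  by rewrite lee_fin; exact: stage_size_max.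
- move=> P.
  apply: (le_trans (staged_expected_samples i0 H mS e0 m_nd theta0 hd P)).
  by rewrite lee_fin; exact: stage_size_expected.
Qed.

End bounded_sampling.

Unset Implicit Arguments.

Theorem mainTheorem9 (R : realType) (c : nat) :
  exists2 K : R, 0 < K &
  forall (d : measure_display) (T : measurableType d) (n : nat)
    (H : 'I_n -> probability T R) (eps rho : R),
    (0 < n)%N -> 0 <= eps <= 1 -> 0 <= rho <= 1 ->
  exists A : algorithm R T n,
    [/\ replicable rho A,
        selects H 3 eps (n%:R ^- c) A,
        worst_case_samples A
          ((K * ln n%:R ^+ 5)%:E / (eps ^+ 2 * rho ^+ 2)%:E)%E
      & expected_samples A
          ((K * ln n%:R ^+ 5)%:E / (eps ^+ 2 * rho)%:E)%E].
Proof.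
(* The expected-count constant 19 * 64 * 4 * 16 exceeds the worst-case one 64 * 4 * 256, so one [C]
   serves both; the last factor is that of [log_budget_cube]. *)
pose C : R := 19 * 64 * 4 * 16 * (4 * (c + 6)%:R ^+ 3).
have C0 : 0 < C by rewrite !mulr_gt0// exprn_gt0// ltr0n addn_gt0 orbT.
exists C => // d T n H eps rho n0 eps01 rho01.
have [e0 e1] := andP eps01; have [r0 r1] := andP rho01.
(* For n = 1 both bounds are 0, even when eps rho = 0, since 0 times [+oo] is 0. *)
have [n1|n1] := leqP n 1%N.
  have nE : n = 1%N by apply/eqP; rewrite eqn_leq n1.
  have ln0 : ln n%:R = 0 :> R by rewrite nE ln1.
  have n1c : n%:R ^- c = 1 :> R by rewrite nE expr1n invr1.
  exists (constant_algorithm R T (Ordinal n0)).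
  rewrite ln0 n1c expr0n mulr0 !mul0e; split.
  - exact: constant_replicable.
  - by move=> P; rewrite subrr.
  - by move=> x r; rewrite /nsamplese.
  - move=> P; under eq_integral do rewrite /nsamplese/=.
    by rewrite integral0.
have L0 : 0 < ln n%:R :> R.
  by apply: lt_le_trans (ln_nat_ge_half R n1); rewrite invr_gt0.
have CL : 0 < C * ln n%:R ^+ 5 by rewrite mulr_gt0// exprn_gt0.
have [er0|er0] := eqVneq (eps * rho) 0.
  have [S mS scheffeS] := scheffe_family H.
  have b0 j : eps ^+ 2 * rho ^+ j.+1 = 0.
    by rewrite expr2 exprS mulrACA er0 mul0r.
  (* The quotient by 0 is [+oo] because its numerator is positive, by [CL]. *)
  have top j : ((C * ln n%:R ^+ 5)%:E / (eps ^+ 2 * rho ^+ j.+1)%:E = +oo)%E.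
    by rewrite b0 inver eqxx gt0_muley// lte_fin.
  exists (unlimited_algorithm (Ordinal n0) H mS); split.
  - exact: unlimited_replicable.
  - by apply: unlimited_selects => //; rewrite invr_ge0 exprn_ge0.
  - by move=> x r; rewrite (top 1%N) leey.
  - by move=> P; rewrite -[rho in X in (_ <= _ / X)%E]expr1 (top 0%N) leey.
move: er0; rewrite mulf_eq0 negb_or => /andP[en0 rn0].
have ep : 0 < eps by rewrite lt_def en0.
have rp : 0 < rho by rewrite lt_def rn0.
have epsp : 0 < eps <= 1 by rewrite ep.
have rhop : 0 < rho <= 1 by rewrite rp.
have [A [hr hs hw he]] := bounded_selection c H n1 epsp rhop.
have cube := log_budget_cube R c n1.
have U0 : 0 <= log_budget R c n ^+ 3.
  by rewrite exprn_ge0// (le_trans _ (log_budget_ge3 R c n1)).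
have bound (D : R) : 0 < D -> ((19 * 64 * 4 * 16 * log_budget R c n ^+ 3 / D)%:E <=
    (C * ln n%:R ^+ 5)%:E / D%:E)%E.
  move=> D0; rewrite inver gt_eqF// -EFinM lee_fin ler_pM2r ?invr_gt0//.
  by rewrite /C; lra.
exists A; split => //.
- move=> x r; apply: (le_trans (hw x r)).
  apply: le_trans (bound _ _); last by rewrite mulr_gt0// exprn_gt0.
  by rewrite lee_fin ler_pM2r ?invr_gt0 ?mulr_gt0 ?exprn_gt0//; lra.
- by move=> P; apply: (le_trans (he P)); apply: bound; rewrite mulr_gt0// exprn_gt0.
Qed.
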